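(* Let $d \ge 1$ and $k \ge 2$ be integers, and let $X$ be a symmetric $\mathbb{C}^{d \times d}$-valued random variable satisfying $\mathbb{E} X = 0$ and $$\mathbb{E} \left[ \Vert X \Vert_{HS}^{2k} \mathbf{1}( \Vert X \Vert_{HS}^{2k} >R ) \right] \to 0 \quad \text{as } R \to \infty.$$ Let $f$ be the random matrix-valued multiplicative function associated to $X$. Then for $x \ge 2$ we have $$\mathbb{E} \left[ \Big\Vert \sum_{n \le x} f(n) \Big\Vert_{HS}^{2 k} \right] \ll x^k (\log x)^{[\rho_{2 k}^2+1] \binom{2 k}{2}-2 k},$$ where $\rho_{2k} = \rho_{2k}(X)$ is the spectral $2k$-radius of $X$ and $[\,\cdot\,]$ denotes the integral part.
   Context: $\mathbb{N} = \{1,2,3,\dots\}$. $\Vert A \Vert_{HS}$ is the Hilbert-Schmidt norm, $\Vert A \Vert_{HS}^2 = \mathrm{Tr}(A^* A)$ for $A \in \mathbb{C}^{d\times d}$. $\mathbf{1}(E)$ is the indicator function of an event $E$. A random variable $X$ is symmetric if $X$ and $-X$ have the same law. The random matrix-valued multiplicative function associated to a $\mathbb{C}^{d\times d}$-valued random variable $X$ is a family $(f(n))_{n \in \mathbb{N}}$ of $\mathbb{C}^{d \times d}$-valued random variables such that: (i) $f(n) = 0$ unless $n$ is squarefree; (ii) the $f(p)$, $p$ prime, are independent and identically distributed with the law of $X$; (iii) if $n = p_1 \cdots p_r$ is squarefree with primes $p_1 < \dots < p_r$, then $f(n) = f(p_1) \cdots f(p_r)$ (matrix product in this order; $f(1)$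 is the identity matrix). For $s \ge 1$ and i.i.d. $\mathbb{C}^{d\times d}$-valued random variables $X, X_1, X_2, \dots$ with $\mathbb{E}[\Vert X \Vert_{HS}^s] < \infty$, the spectral $s$-radius of $X$ is $$\rho_s := \rho_s(X) := \lim_{n \to \infty} \mathbb{E}\left[ \Vert X_1 \cdots X_n \Vert_{HS}^s \right]^{\frac{1}{s n}}.$$ The implied constant in $\ll$ may depend on $d$, $k$ and the law of $X$, but not on $x$. *)

(* Defs.v *)
From HB Require Import structures.
From mathcomp Require Import all_boot all_order all_algebra.
From mathcomp Require Import all_classical all_reals all_analysis.
From mathcomp Require Import complex.

Set Implicit Arguments.
Unset Strict Implicit.
Unset Printing Implicit Defensive.

Import Order.TTheory GRing.Theory Num.Theory.
Import numFieldNormedType.Exports.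

Local Open Scope classical_set_scope.
Local Open Scope ring_scope.
Local Open Scope complex_scope.

Definition adjoint_mx (R : realType) (d : nat) (A : 'M[R[i]]_d) : 'M[R[i]]_d :=
  map_mx conjc A^T.

(* The trace of A^* A is real, so its real part is the trace itself. *)
Definition hs_norm (R : realType) (d : nat) (A : 'M[R[i]]_d) : R :=
  Num.sqrt (complex.Re (\tr (adjoint_mx A *m A))).

(* The Borel sigma-algebra of C^(d x d), identified with R^(2 d^2): it is
   generated by the real and imaginary parts of the entries. *)
Definition mx_coord_sets (R : realType) (d : nat) : set (set 'M[R[i]]_d) :=
  [set U | exists (i j : 'I_d) (B : set R), measurable B /\
    (U = [set A : 'M[R[i]]_d | B (complex.Re (A i j))] \/
     U = [set A : 'M[R[i]]_d | B (complex.Im (A i j))])].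

(* [g_sigma_algebraType] is a measurableType only over a pointed type. *)
HB.instance Definition _ (R : realType) := isPointed.Build R[i] 0.

Definition mxBorel (R : realType) (d : nat) :=
  g_sigma_algebraType (@mx_coord_sets R d).

Definition random_mx (disp : measure_display) (T : measurableType disp)
    (R : realType) (d : nat) (X : T -> 'M[R[i]]_d) : Prop :=
  measurable_fun [set: T] (X : T -> mxBorel R d).

(* Library measures are total functions, arbitrary outside the measurable sets,
   so laws are only compared on Borel sets. *)
Definition same_law (R : realType) (d : nat)
    (disp : measure_display) (T : measurableType disp) (P : probability T R)
    (X : T -> 'M[R[i]]_d)
    (disp' : measure_display) (T' : measurableType disp') (P' : probability T' R)
    (X' : T' -> 'M[R[i]]_d) : Prop :=
  forall B : set (mxBorel R d), measurable B -> P (X @^-1` B) = P' (X' @^-1` B).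

Definition symmetric_mx (R : realType) (d : nat)
    (disp : measure_display) (T : measurableType disp) (P : probability T R)
    (X : T -> 'M[R[i]]_d) : Prop :=
  same_law P X P (fun w => - X w).

Definition centered_mx (R : realType) (d : nat)
    (disp : measure_display) (T : measurableType disp) (P : probability T R)
    (X : T -> 'M[R[i]]_d) : Prop :=
  forall i j : 'I_d,
    ('E_P[fun w => complex.Re (X w i j)] = 0 /\
     'E_P[fun w => complex.Im (X w i j)] = 0)%E.

Definition mutually_independent (R : realType) (d : nat)
    (disp : measure_display) (T : measurableType disp) (P : probability T R)
    (D : set nat) (Y : nat -> T -> 'M[R[i]]_d) : Prop :=
  forall (s : seq nat) (B : nat -> set (mxBorel R d)),
    uniq s -> (forall n, n \in s -> D n) -> (forall n, measurable (B n)) ->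
    (P (\bigcap_(n in [set` s]) (Y n @^-1` B n)) =
     \prod_(n <- s) P (Y n @^-1` B n))%E.

(* The (Y n), n in D, are i.i.d. with the law of X. *)
Definition iid_copies (R : realType) (d : nat)
    (disp : measure_display) (T : measurableType disp) (P : probability T R)
    (X : T -> 'M[R[i]]_d)
    (disp' : measure_display) (T' : measurableType disp') (P' : probability T' R)
    (D : set nat) (Y : nat -> T' -> 'M[R[i]]_d) : Prop :=
  [/\ forall n, D n -> random_mx (Y n),
      mutually_independent P' D Y
    & forall n, D n -> same_law P' (Y n) P X].

Definition squarefree (n : nat) : Prop :=
  (0 < n)%N /\ forall p, prime p -> ~~ (p ^ 2 %| n)%N.

(* The list [primes n] is increasing and the big product is taken in list order;
   the value f 0 is irrelevant. *)
Definition random_mult_fun (R : realType) (d : nat)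
    (disp : measure_display) (T : measurableType disp) (P : probability T R)
    (X : T -> 'M[R[i]]_d)
    (disp' : measure_display) (T' : measurableType disp') (P' : probability T' R)
    (f : nat -> T' -> 'M[R[i]]_d) : Prop :=
  [/\ forall n, (0 < n)%N -> ~ squarefree n -> forall w, f n w = 0,
      iid_copies P X P' [set p | prime p] f
    & forall n, squarefree n -> forall w, f n w = \prod_(p <- primes n) f p w].

(* The spectral s-radius of the common law of an i.i.d. sequence Y;
   Y n stands for X_(n+1). *)
Definition spectral_radius (R : realType) (d : nat)
    (disp : measure_display) (T : measurableType disp) (P : probability T R)
    (Y : nat -> T -> 'M[R[i]]_d) (s : R) : R :=
  limn (fun n : nat =>
    fine 'E_P[fun w => (hs_norm (\prod_(i < n) Y i w) `^ s)%R]%E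
      `^ (s * n%:R)^-1).

(* Main.v *)
Require Import Defs.
From HB Require Import structures.
From mathcomp Require Import all_boot all_order all_algebra.
From mathcomp Require Import all_classical all_reals all_analysis.
From mathcomp Require Import measurable_realfun.
From mathcomp Require Import complex.
From mathcomp Require Import zify ring lra.

(* By symmetry of X, the signs of the f(p) can be changed independently without
   changing the law of S = sum_(n <= x) f(n).  Averaging over all signs, only the
   tuples (n_1, ..., n_2k) whose product is a square survive in the expansion of
   |S|^(2k).  As N = [rho^2 + 1] > rho^2, Fekete's lemma gives
   E |X_1 ... X_r|^(2k) << N^(k r), so the moment is << sum prod_i a^(omega(n_i))
   over the square tuples of squarefree numbers, with a^2 = N.

   Pairing up the indices i with p | n_i, for each prime p, writes
   n_i = prod_(e containing i, l < N) g_(e,l), where e ranges over the 2-subsets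
   of the indices, in at least N^(sum_i omega(n_i) / 2) ways.  Hence the weighted
   sum is at most the number of families g with all these products at most x.
   With 2^(a_(e,l)) <= g_(e,l) < 2^(a_(e,l) + 1) and 2^m <= x < 2^(m + 1), this is
   at most the sum of 2^(sum a) over the a >= 0 whose slacks
   v_i = m - sum_(e containing i, l) a_(e,l) are nonnegative.  Here
   2 sum a = 2 k m - sum v, and a is determined by v together with its
   coordinates off a triangle with pendant edges spanning the 2k indices, whose
   incidence matrix is invertible.  Summing the geometric series in v leaves
   2^(k m) (m + 1)^(N binom(2k, 2) - 2k). *)

Set Implicit Arguments.
Unset Strict Implicit.
Unset Printing Implicit Defensive.

Import Order.TTheory GRing.Theory Num.Theory.
Import numFieldNormedType.Exports.

(** * Counting square tuples *)

Lemma squarefree_dvd m n : m %| n -> squarefree n -> squarefree m.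
Proof.
move=> mn [n0 sqn]; split; first exact: dvdn_gt0 mn.
by move=> p pp; apply: contra (sqn p pp) => /dvdn_trans; exact.
Qed.

Lemma squarefree_dvdn_div p n : prime p -> p %| n -> squarefree n -> ~~ (p %| n %/ p).
Proof.
move=> pp pn [_ sqn]; apply: contra (sqn p pp) => pnp.
by rewrite -(divnK pn) expnS expn1 dvdn_mul.
Qed.

Lemma size_primes_div p n : prime p -> p %| n -> squarefree n ->
  size (primes n) = (size (primes (n %/ p))).+1.
Proof.
move=> pp pn sn.
have pnp := squarefree_dvdn_div pp pn sn.
have n0 : 0 < n by case: sn.
have np0 : 0 < n %/ p by rewrite divn_gt0 ?prime_gt0// dvdn_leq.
rewrite -[RHS]/(size (p :: primes (n %/ p))); apply/perm_size/uniq_perm.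
- exact: primes_uniq.
- by rewrite /= primes_uniq andbT mem_primes (negbTE pnp) !andbF.
move=> q; rewrite inE -{1}(divnK pn) primesM ?(prime_gt0 pp)// orbC.
by rewrite primes_prime// inE.
Qed.

(** * Distributing prime factors over labelled edges of a complete graph *)

Section Edges.
Variable I : finType.

Definition edge := {e : {set I} | #|e| == 2}.

Lemma card_edge : #|{: edge}| = 'C(#|I|, 2).
Proof. by rewrite card_sig -card_draws cardsE. Qed.

Lemma edge2_subproof (i j : I) : i != j -> #|[set i; j]| == 2.
Proof. by move=> ij; rewrite cards2 ij. Qed.

Definition edge2 (i j : I) (ij : i != j) : edge := Sub [set i; j] (edge2_subproof ij).

Lemma edge_size (e : edge) : #|val e| = 2.
Proof. exact/eqP/(valP e). Qed.

Variable N : nat.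
Local Notation E := (edge * 'I_N)%type.

Definition incident (i : I) (e : E) := i \in val e.1.

(** Bounding the values by X makes the set finite. Nothing is lost when 0 < n i <= X for all i,
    since [g e] divides [n i] at each end i of e. *)
Definition factorizations X (n : I -> nat) :=
  [set g : {ffun E -> 'I_X.+1} | [forall e, 0 < g e] &&
     [forall i, \prod_(e | incident i e) (g e : nat) == n i]].

Lemma factorizationsP X n (g : {ffun E -> 'I_X.+1}) :
  reflect ((forall e, 0 < g e) /\
           (forall i, \prod_(e | incident i e) (g e : nat) = n i))
          (g \in factorizations X n).
Proof.
rewrite inE; apply: (iffP andP) => -[g0 gn]; split.
- exact/forallP.
- by move=> i; apply/eqP; move/forallP: gn.
- exact/forallP.
- by apply/forallP => i; exact/eqP.
Qed.

(* The factor p is put on the edge {i, j} with one of N labels; the label can be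
   recovered because n' i is not divisible by p. *)
Lemma card_factorizations_mulp X (n n' : I -> nat) p i j (ij : i != j) :
  prime p -> (forall x, n x <= X) -> (forall x, 0 < n x) ->
  (forall x, n x = if x \in [set i; j] then p * n' x else n' x) ->
  ~~ (p %| n' i) ->
  N * #|factorizations X n'| <= #|factorizations X n|.
Proof.
move=> pp nX n0 nn' pi.
pose e0 l : E := (edge2 ij, l).
have inc0 x l : incident x (e0 l) = (x \in [set i; j]) by [].
have ie0 l : incident i (e0 l) by rewrite inc0 !inE eqxx.
pose h (gl : {ffun E -> 'I_X.+1} * 'I_N) : {ffun E -> 'I_X.+1} :=
  [ffun e => if e == e0 gl.2 then inord (p * gl.1 e) else gl.1 e].
have le_pg g l : g \in factorizations X n' -> p * g (e0 l) <= X.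
  move=> /factorizationsP[g0 gn]; apply: leq_trans (nX i).
  rewrite nn' !inE eqxx/= leq_mul2l; apply/orP; right.
  apply: dvdn_leq; first by have := n0 i; rewrite nn' !inE eqxx muln_gt0 => /andP[].
  by rewrite -gn (bigD1 (e0 l))//= dvdn_mulr.
have hE g l e : g \in factorizations X n' ->
    h (g, l) e = (if e == e0 l then p * g e else g e) :> nat.
  by move=> gF; rewrite ffunE/=; case: eqP => // ->; rewrite inordK// ltnS le_pg.
have pg g l : g \in factorizations X n' -> ~~ (p %| g (e0 l)).
  move=> /factorizationsP[g0 gn]; apply: contra pi => /dvdn_trans; apply.
  by rewrite -gn (bigD1 (e0 l))//= dvdn_mulr.
pose S := finset.setX (factorizations X n') [set: 'I_N].
have -> : N * #|factorizations X n'| = #|S| by rewrite cardsX cardsT card_ord mulnC.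
rewrite -(card_in_imset (f := h) (D := S)).
  apply/subset_leq_card/fintype.subsetP => _ /imsetP[[g l] /finset.setXP[gF _]] ->.
  have /factorizationsP[g0 gn] := gF.
  apply/factorizationsP; split => [e|x].
    by rewrite hE//; case: ifP => _; rewrite ?muln_gt0 ?(prime_gt0 pp) g0.
  under eq_bigr do rewrite hE//.
  rewrite nn' -gn; case: ifPn => xij.
    rewrite (bigD1 (e0 l))/= ?inc0 // eqxx -mulnA; congr (_ * _).
    rewrite [RHS](bigD1 (e0 l)) ?inc0//=; congr (_ * _).
    by apply: eq_bigr => e /andP[_ /negbTE ->].
  by apply: eq_bigr => e; case: eqP => // ->; rewrite inc0 (negbTE xij).
move=> [g l] [g' l'] /finset.setXP[gF _] /finset.setXP[gF' _] /= hh.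
have hhE e : (if e == e0 l then p * g e else g e) =
             (if e == e0 l' then p * g' e else g' e) :> nat.
  by rewrite -hE// -hE// hh.
have ll : l = l'.
  apply/eqP; apply: contraT => ll; have := hhE (e0 l); rewrite eqxx ifN.
    by move=> H; have := pg _ l gF'; rewrite -H dvdn_mulr.
  by apply: contra ll => /eqP[->].
subst l'; congr (_, _); apply/ffunP => e; apply/val_inj => /=.
have := hhE e; case: ifP => // _ /eqP.
by rewrite eqn_pmul2l ?prime_gt0// => /eqP.
Qed.

(** Induction on the total number of prime factors. A prime p dividing some n_i divides a second n_j
    by parity; dividing both by p lowers the total by 2, and putting p back costs a choice among N
    labels. *)
Lemma card_factorizations X (n : I -> nat) :
  0 < X -> (forall i, n i <= X) -> (forall i, squarefree (n i)) ->
  (forall p, prime p -> ~~ odd #|[set i | p %| n i]|) ->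
  exists s, \sum_i size (primes (n i)) = s.*2 /\ N ^ s <= #|factorizations X n|.
Proof.
move=> X0; have [m] := ubnP (\sum_i size (primes (n i))).
elim: m n => // m IH n; rewrite ltnS => le_m nX sn even_n.
have n0 i : 0 < n i by case: (sn i).
have [/forallP n1|/forallPn[i ni]] := boolP [forall i, n i == 1].
  exists 0; split; first by rewrite big1// => i _; rewrite (eqP (n1 i)).
  rewrite expn0 card_gt0; apply/set0Pn.
  exists [ffun=> inord 1]; apply/factorizationsP; split=> [e|i].
    by rewrite ffunE inordK.
  rewrite (eqP (n1 i)) big1// => e _; by rewrite ffunE inordK.
pose p := pdiv (n i).
have pp : prime p by rewrite pdiv_prime// ltn_neqAle eq_sym ni n0.
have pi : p %| n i by exact: pdiv_dvd.
have [j /andP[ji pj]] : exists j, (j != i) && (p %| n j).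
  have := even_n p pp; rewrite (cardsD1 i) inE pi/= negbK => odd_rest.
  have /card_gt0P[j] : 0 < #|[set i0 | p %| n i0] :\ i| by case: #|_| odd_rest.
  by rewrite !inE => ?; exists j.
rewrite eq_sym in ji.
pose n' x := if x \in [set i; j] then n x %/ p else n x.
have n'_dvd x : n' x %| n x.
  by rewrite /n' !inE; case: ifP => // /orP[]/eqP->; rewrite dvdn_div.
have nn' x : n x = if x \in [set i; j] then p * n' x else n' x.
  by rewrite /n'; case xij: (x \in _) => //; case/set2P: xij => ->; rewrite mulnC divnK.
have pn' x : x \in [set i; j] -> ~~ (p %| n' x).
  by rewrite /n' => xij; rewrite xij; apply: squarefree_dvdn_div => //;
    by case/set2P: xij => ->.
have w_n' : \sum_i size (primes (n i)) = (\sum_i size (primes (n' i))).+2.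
  rewrite [LHS](bigD1 i)//= [in LHS](bigD1 j) 1?eq_sym//= [in RHS](bigD1 i)//=.
  rewrite [in RHS](bigD1 j) 1?eq_sym//=.
  have -> : n' i = n i %/ p by rewrite /n' !inE eqxx.
  have -> : n' j = n j %/ p by rewrite /n' !inE eqxx orbT.
  rewrite (size_primes_div pp pi)// (size_primes_div pp pj)// !addSn !addnS.
  do 2 congr _.+1; congr (_ + (_ + _))%N.
  by apply: eq_bigr => x /andP[xi xj]; rewrite /n' !inE (negbTE xi) (negbTE xj).
have [||||s [sE sF]] := IH n'.
- by move: le_m; rewrite w_n'; apply: leq_trans.
- by move=> x; apply: leq_trans (nX x); exact: dvdn_leq.
- by move=> x; exact: squarefree_dvd (sn x).
(* For q = p the set of indices loses exactly i and j; for any other prime it is unchanged. *)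
- move=> q qp; have [->|qp'] := eqVneq q p.
    have := even_n p pp; rewrite (cardsD1 i) inE pi/= (cardsD1 j) !inE eq_sym ji pj/=.
    rewrite negbK; congr (~~ odd _); apply: eq_card => x; rewrite !inE.
    have [->|xi] := eqVneq x i.
      by rewrite andbF; apply/esym/negbTE/pn'; rewrite !inE eqxx.
    have [->|xj] := eqVneq x j.
      by apply/esym/negbTE/pn'; rewrite !inE eqxx orbT.
    by rewrite /= /n' !inE (negbTE xi) (negbTE xj).
  have := even_n q qp; congr (~~ odd _); apply: eq_card => x; rewrite !inE nn'.
  by case: ifP => // _; rewrite Euclid_dvdM// dvdn_prime2// (negbTE qp').
exists s.+1; split; first by rewrite w_n' sE.
rewrite expnS; apply: leq_trans (leq_mul (leqnn N) sF) _.
apply: (card_factorizations_mulp ji pp nX n0 nn').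
by apply: pn'; rewrite !inE eqxx.
Qed.
End Edges.

Section SumInjection.
Variables (R : numDomainType) (A B : finType).
Local Open Scope ring_scope.

Lemma ler_sum_inj (P : pred A) (Q : pred B) (h : A -> B) (F : B -> R) :
  {in P &, injective h} -> (forall a, P a -> Q (h a)) ->
  (forall b, Q b -> 0 <= F b) ->
  \sum_(a | P a) F (h a) <= \sum_(b | Q b) F b.
Proof.
move=> h_inj PQ F0.
rewrite -(big_imset F h_inj)/= [leRHS](bigID [in h @: P])/=.
rewrite [X in _ <= X + _](eq_bigl [in h @: P]); last first.
  by move=> b; rewrite andb_idl// => /imsetP[a Pa ->]; exact: PQ.
by rewrite lerDl sumr_ge0// => b /andP[Qb _]; exact: F0.
Qed.
End SumInjection.

(** * Dyadic decomposition and lattice points under vertex constraints *)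

Section LatticePoints.
Variables (I E : finType) (incident : I -> E -> bool).

(** The bound l on each coordinate only makes the set finite: it follows from the constraint at an
    end of the edge. *)
Definition subpolytope l := [set a : {ffun E -> 'I_l.+1} |
  [forall i, \sum_(e | incident i e) (a e : nat) <= l]].

(** The shift by 2^b embeds the dyadic interval [2^b, 2^(b+1)) into the numbers below 2^b. *)
Lemma card_dyadic X b :
  #|[pred x : 'I_X.+1 | (0 < x) && (trunc_log 2 x == b)]| <= 2 ^ b.
Proof.
pose h (x : 'I_X.+1) : 'I_(2 ^ b).+1 := inord (x - 2 ^ b).
have bnd (x : 'I_X.+1) : (0 < x) && (trunc_log 2 x == b) -> 2 ^ b <= x < 2 ^ b.+1.
  by move=> /andP[x0 /eqP <-]; exact: trunc_log_bounds.
have hE (x : 'I_X.+1) : 2 ^ b <= x < 2 ^ b.+1 -> h x = x - 2 ^ b :> nat.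
  move=> /andP[bx xb]; rewrite inordK// ltnS leq_subLR addnn -mul2n -expnS.
  exact: ltnW.
rewrite -(card_in_image (f := h)).
  rewrite -[X in _ <= X](card_ord (2 ^ b)).
  (* The codomain of [h] has one value too many, so that [inord] is available; [w] shows that the
     top value is not attained. *)
  pose w (x : 'I_(2 ^ b)) := widen_ord (leqnSn (2 ^ b)) x.
  have winj : injective w by move=> x y [] /val_inj.
  rewrite -(card_codom winj); apply/subset_leq_card/fintype.subsetP => y.
  move=> /fintype.imageP[x] /bnd bx ->.
  have lt : x - 2 ^ b < 2 ^ b.
    by rewrite ltn_subLR; case/andP: bx => // _; rewrite addnn -mul2n -expnS.
  by apply/codomP; exists (Ordinal lt); apply/val_inj; rewrite /= hE.
move=> x y /bnd bx /bnd by_ hh.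
have : h x = h y :> nat by rewrite hh.
rewrite !hE//; case/andP: bx => bx _; case/andP: by_ => by_ _ xy.
by apply/val_inj; rewrite /= -(subnK bx) -(subnK by_) xy.
Qed.

(** Families are grouped by their dyadic exponents a. Since 2^(a e) <= g e, these satisfy the
    constraints of [subpolytope], and each group lies in a product of dyadic intervals with at most
    2^(a e) elements each. *)
Lemma card_subproducts X : 0 < X ->
  #|[set g : {ffun E -> 'I_X.+1} | [forall e, 0 < g e] &&
      [forall i, \prod_(e | incident i e) (g e : nat) <= X]]| <=
  \sum_(a in subpolytope (trunc_log 2 X)) 2 ^ \sum_e a e.
Proof.
set l := trunc_log 2 X => X0; set B := [set g | _].
pose al (g : {ffun E -> 'I_X.+1}) : {ffun E -> 'I_l.+1} :=
  [ffun e => inord (trunc_log 2 (g e))].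
have alE (g : {ffun E -> 'I_X.+1}) e : al g e = trunc_log 2 (g e) :> nat.
  by rewrite ffunE inordK// ltnS leq_trunc_log// -ltnS.
rewrite -sum1_card (partition_big al (mem (subpolytope l)))/=; last first.
  move=> g; rewrite !inE => /andP[/forallP g0 /forallP gX]; apply/forallP => i.
  apply: trunc_log_max => //; rewrite expn_sum; apply: leq_trans (gX i).
  by apply: leq_prod => e _; rewrite alE trunc_logP.
apply: leq_sum => a _; rewrite expn_sum.
apply: (@leq_trans (\prod_e #|[pred x : 'I_X.+1 | (0 < x) && (trunc_log 2 x == a e)]|)).
  rewrite [leqRHS](eq_bigr (fun e => \sum_(x : 'I_X.+1 |
    (0 < x) && (trunc_log 2 x == a e)) 1)); last by move=> e _; rewrite sum1_card.
  rewrite bigA_distr_big_dep/= [leqRHS](eq_bigr (fun=> 1)); last first.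
    by move=> g _; rewrite big1_eq.
  rewrite !sum1_card; apply/subset_leq_card/fintype.subsetP => g.
  rewrite unfold_in => /andP[]; rewrite inE => /andP[/forallP g0 _] /eqP <-.
  by apply/familyP => e; rewrite unfold_in /= g0 -alE eqxx.
by apply: leq_prod => e _; exact: card_dyadic.
Qed.

Variables (two_ends : forall e, #|incident^~ e| = 2).

Lemma handshake (F : E -> nat) :
  \sum_i \sum_(e | incident i e) F e = (\sum_e F e).*2.
Proof.
rewrite (exchange_big_dep predT)//= -muln2 big_distrl/=; apply: eq_bigr => e _.
by rewrite sum_nat_const mulnC; congr (_ * _); rewrite -(two_ends e).
Qed.

Variables (o1 o2 o3 : I) (tau : I -> E).
Hypotheses (o21 : o2 != o1) (o31 : o3 != o1) (o32 : o3 != o2).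
(** Indexing the selected edges by the vertices makes their incidence matrix square; by [tau_inj]
    exactly #|I| edges are selected. *)
Hypothesis tauE : forall i j, incident j (tau i) =
  if i == o1 then (j == o2) || (j == o3) else (j == o1) || (j == i).

Lemma tau_inj : injective tau.
Proof.
move=> i j ij.
have := tauE i o1; have := tauE j o1; rewrite -ij => ->.
rewrite eqxx !(eq_sym o1) (negbTE o21) (negbTE o31)/=.
have [->|jo] := eqVneq j o1; have [->//|io] := eqVneq i o1 => // _.
by have := tauE i j; rewrite ij tauE (negbTE jo) (negbTE io) eqxx orbT/= => /esym/eqP.
Qed.

(* [tau] selects the triangle o1 o2 o3 and the pendant edges from o1. *)
Lemma tree_triangle_eq0 (D : E -> int) :
  (forall e, e \notin codom tau -> D e = 0%R) ->
  (forall i, \sum_(e | incident i e) D e = 0)%R -> forall e, D e = 0%R.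
Proof.
move=> D0 sumD.
have sumD' j : (\sum_(i | incident j (tau i)) D (tau i) = 0)%R.
  rewrite -[RHS](sumD j) [RHS](bigID [in codom tau])/= [X in (_ = _ + X)%R]big1 ?addr0.
    rewrite [RHS](reindex_onto tau (fun e => odflt o1 [pick i | tau i == e])).
      apply: eq_bigl => i; rewrite codom_f andbT; case: pickP => /=.
        by move=> x /eqP/tau_inj ->; rewrite eqxx andbT.
      by move=> /(_ i); rewrite eqxx.
    move=> e /andP[_ /codomP[i ->]]; case: pickP => [x /eqP //|/(_ i)].
    by rewrite eqxx.
  by move=> e /andP[_ /D0].
(* A vertex j other than o1 meets [tau j], and also [tau o1] when j is o2 or o3, so its equation
   expresses D (tau j) through D (tau o1). *)
have D_leaf j : j != o1 ->
    (D (tau j) = - (D (tau o1) *+ ((j == o2) || (j == o3))))%R.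
  move=> jo; apply/eqP; rewrite -addr_eq0; apply/eqP.
  rewrite -[RHS](sumD' j) (bigD1 j)/=; last first.
    by rewrite tauE (negbTE jo) eqxx orbT.
  congr (_ + _)%R; have [jo23|jo23] := boolP (_ || _).
    rewrite (big_pred1 o1)// => i /=; rewrite tauE jo23 (negbTE jo)/= .
    by case: (eqVneq i o1) => [->|io]; rewrite ?(eq_sym o1) ?jo// eq_sym andbN.
  rewrite big_pred0 ?mulr0n// => i; rewrite tauE (negbTE jo23) (negbTE jo)/=.
  by case: (eqVneq i o1) => // io; rewrite eq_sym andbN.
(* The equation at o1 becomes -2 D (tau o1) = 0: the cycle is odd, so the contributions of o2 and o3
   add up instead of cancelling. *)
have D_o1 : D (tau o1) = 0%R.
  have := sumD' o1; rewrite (bigD1 o2)/=; last by rewrite tauE (negbTE o21) eqxx.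
  rewrite (bigD1 o3)/=; last by rewrite tauE (negbTE o31) eqxx.
  rewrite big1 ?addr0.
    rewrite (D_leaf o2 o21) (D_leaf o3 o31) !eqxx orbT mulr1n => /eqP.
    by rewrite -opprD oppr_eq0 -mulr2n mulrn_eq0/= => /eqP.
  move=> i /andP[/andP[oi i2] i3].
  have io : i != o1.
    apply: contraTneq oi => ->.
    by rewrite tauE eqxx !(eq_sym o1) (negbTE o21) (negbTE o31).
  by rewrite (D_leaf i io) (negbTE i2) (negbTE i3) mulr0n oppr0.
move=> e; have [/codomP[j ->]|/D0//] := boolP (e \in codom tau).
by have [->//|jo] := eqVneq j o1; rewrite D_leaf// D_o1 mul0rn oppr0.
Qed.

Local Open Scope ring_scope.

(** Multiplication by 1 - r >= 1/4 telescopes the sum to 1 - r^n <= 1. It is applied with r = 1 /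
    sqrt 2. *)
Lemma geometric_sum_le (R : realFieldType) (r : R) n :
  0 <= r <= 3 / 4 -> \sum_(v < n) r ^+ v <= 4.
Proof.
move=> /andP[r0 r1].
have q0 : 0 < 1 - r by lra.
rewrite -(ler_pM2l q0) -[leLHS]opprK -mulNr opprB -subrX1 opprB.
have : 0 <= r ^+ n by rewrite exprn_ge0.
lra.
Qed.

(** With s = sqrt 2, [handshake] turns 2^(sum a) into the product over i of s^(row a i), which is
    s^(l #|I|) times the product of s^-1 raised to the slacks. Replacing a by its coordinates off
    [codom tau] and its slacks, and then letting these vary freely, leaves a product of geometric
    series. *)
Lemma sum_subpolytope_le (R : rcfType) k l : #|I| = k.*2 ->
  \sum_(a in subpolytope l) (2 ^+ (\sum_e a e) : R) <=
  (2 ^+ l) ^+ k * l.+1%:R ^+ (#|E| - #|I|) * 4 ^+ #|I|.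
Proof.
move=> Ik; set s := Num.sqrt (2 : R).
have s0 : 0 < s by rewrite sqrtr_gt0.
have ss : s ^+ 2 = 2 by rewrite sqr_sqrtr.
pose row (a : {ffun E -> 'I_l.+1}) i := (\sum_(e | incident i e) (a e : nat))%N.
pose h (a : {ffun E -> 'I_l.+1}) : {ffun E -> 'I_l.+1} * {ffun I -> 'I_l.+1} :=
  ([ffun e => if e \in codom tau then ord0 else a e],
   [ffun i => inord (l - row a i)]).
pose F (bv : {ffun E -> 'I_l.+1} * {ffun I -> 'I_l.+1}) : R :=
  (2 ^+ l) ^+ k * \prod_i s^-1 ^+ bv.2 i.
pose Q (bv : {ffun E -> 'I_l.+1} * {ffun I -> 'I_l.+1}) :=
  bv.1 \in pffun_on ord0 [predC codom tau] predT.
have row_le a i : a \in subpolytope l -> (row a i <= l)%N.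
  by rewrite inE => /forallP/(_ i).
have hE a i : (h a).2 i = (l - row a i)%N :> nat.
  by rewrite ffunE inordK// ltnS leq_subr.
have -> : \sum_(a in subpolytope l) (2 ^+ (\sum_e a e) : R) =
          \sum_(a in subpolytope l) F (h a).
  apply: eq_bigr => a aP.
  have -> : F (h a) = (s ^+ l) ^+ #|I| * \prod_i s^-1 ^+ (l - row a i).
    rewrite /F; congr (_ * _); last by apply: eq_bigr => i _; rewrite hE.
    by rewrite Ik -ss -!exprM mulnCA mulnA -mul2n; congr (_ ^+ _); lia.
  rewrite -prodr_const -big_split/=.
  rewrite -ss -exprM mul2n -handshake expr_sum; apply: eq_bigr => i _.
  have -> : s ^+ l = s ^+ (l - row a i) * s ^+ row a i by rewrite -exprD subnK ?row_le.
  rewrite -/(row a i) mulrAC -exprMn.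
  by rewrite divff ?gt_eqF// expr1n mul1r.
apply: le_trans (_ : \sum_(bv | Q bv) F bv <= _).
  apply: ler_sum_inj => [a b aP bP hh|a aP|bv _].
  (* Two points with the same image differ by a vector that vanishes off [codom tau] and has zero
     sum at every vertex. *)
  - apply/ffunP => e; apply/val_inj/eqP => /=; rewrite -eqz_nat -subr_eq0.
    apply/eqP; apply: (tree_triangle_eq0 (D := fun e => (a e)%:Z - (b e)%:Z)).
      move=> e0 e0T; have := congr1
        (fun x : {ffun E -> 'I_l.+1} * {ffun I -> 'I_l.+1} => x.1 e0) hh.
      by rewrite /= !ffunE (negbTE e0T) => ->; rewrite subrr.
    move=> i; rewrite sumrB -!(big_morph _ PoszD (erefl _)).
    have : row a i = row b i.
      have := congr1
        (fun x : {ffun E -> 'I_l.+1} * {ffun I -> 'I_l.+1} => x.2 i : nat) hh.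
      rewrite /= !hE.
      have := row_le a i aP; have := row_le b i bP; lia.
    by rewrite /row => ->; rewrite subrr.
  - apply/pffun_onP; split => //; apply/fintype.subsetP => e.
    by rewrite !inE /= ffunE; case: ifP.
  - rewrite mulr_ge0 ?exprn_ge0// prodr_ge0// => i _.
    by rewrite exprn_ge0// invr_ge0 ltW.
have -> : \sum_(bv | Q bv) F bv =
   (2 ^+ l) ^+ k * ((\sum_(b in pffun_on (ord0 : 'I_l.+1) [predC codom tau] predT) 1) *
                     \sum_v \prod_i s^-1 ^+ (v : {ffun I -> 'I_l.+1}) i).
  rewrite big_distrlr pair_big/= big_distrr/=.
  by apply: eq_big => [[b v]|[b v] _] //=; rewrite ?andbT// mul1r.
rewrite -mulrA ler_wpM2l ?exprn_ge0//.
rewrite sumr_const card_pffun_on -natrX.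
have -> : #|(predT : {pred 'I_l.+1})| = l.+1.
  by rewrite -[RHS](card_ord l.+1); apply: eq_card.
have -> : #|[predC codom tau]| = (#|E| - #|I|)%N.
  by rewrite -(cardC [in codom tau]) card_codom ?addKn//; exact: tau_inj.
rewrite ler_wpM2l// -(bigA_distr_bigA (fun (i : I) (x : 'I_l.+1) => s^-1 ^+ x)).
rewrite -prodr_const; apply: ler_prod => i _.
rewrite sumr_ge0 => [/=|v _]; last by rewrite exprn_ge0// invr_ge0 ltW.
apply: geometric_sum_le; rewrite invr_ge0 ltW//=.
(* This is 16/9 <= 2, and it gives the ratio 1/s <= 3/4. *)
have : 4 / 3 <= s by rewrite -ler_sqr ?nnegrE ?ss ?ltW//; lra.
by move=> s43; rewrite -(@ler_pM2r _ s)// mulVf ?gt_eqF//; lra.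
Qed.
End LatticePoints.

(** * The weighted count of square tuples *)

Section Count.
Variables (R : rcfType) (I : finType) (k N X : nat) (a : R).
Hypotheses (Ik : #|I| = k.*2) (k2 : 2 <= k) (N0 : 0 < N) (X0 : 0 < X).
Hypothesis aN : (a ^+ 2 = N%:R)%R.
Local Notation E := (edge I * 'I_N)%type.

(** As k >= 2, there are at least four indices, enough for a triangle. *)
Lemma exists_three : exists o : I * I * I,
  [&& o.1.2 != o.1.1, o.2 != o.1.1 & o.2 != o.1.2].
Proof.
have := enum_uniq I; have := cardE I; rewrite Ik.
case: (enum I) => [|x [|y [|z s]]] /=; try lia.
rewrite !inE !negb_or -!andbA => _ /and5P[xy xz _ yz _].
by exists (x, y, z); rewrite /= !(eq_sym z) xz yz eq_sym xy.
Qed.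

Lemma sum_subpolytope_edges_le l :
  (\sum_(f in subpolytope (@incident I N) l) (2 ^+ (\sum_e f e) : R) <=
  (2 ^+ l) ^+ k * l.+1%:R ^+ (N * 'C(k.*2, 2) - k.*2) * 4 ^+ k.*2)%R.
Proof.
have [[[ o1 o2] o3] /= /and3P[ o21 o31 o32]] := exists_three.
pose S i : {set I} := if i == o1 then [set o2; o3] else [set o1; i].
have S2 i : #|S i| == 2.
  rewrite /S; case: ifPn => io; rewrite cards2; first by rewrite (eq_sym o2) o32.
  by rewrite (eq_sym o1) io.
(* All selected edges carry the label 0, which exists because N > 0. *)
pose tau i : E := (Sub (S i) (S2 i) : edge I, Ordinal N0).
have tauE i j : incident j (tau i) =
    if i == o1 then (j == o2) || (j == o3) else (j == o1) || (j == i).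
  by rewrite /incident /tau /= /S; case: ifP; rewrite !inE.
have two_ends (e : E) : #|@incident I N ^~ e| = 2.
  by rewrite -(edge_size e.1); apply: eq_card.
have := @sum_subpolytope_le _ _ _ two_ends _ _ _ _ o21 o31 o32 tauE R k l Ik.
by rewrite card_prod card_ord card_edge Ik mulnC.
Qed.

(** By [card_factorizations] the weight a^(2s) = N^s of a tuple is at most its number of
    factorizations. Different tuples share no factorization, because g determines each n_i as a
    product, so the total is at most the number of families with all products at most X. *)
Lemma weighted_square_tuples_le (good : pred {ffun I -> 'I_X.+1}) :
  (forall n, good n -> (forall i, squarefree (n i)) /\
     (forall p, prime p -> ~~ odd #|[set i | p %| n i]|)) ->
  (\sum_(n | good n) a ^+ (\sum_i size (primes (n i))) <=
  (2 ^+ (trunc_log 2 X)) ^+ k * (trunc_log 2 X).+1%:R ^+ (N * 'C(k.*2, 2) - k.*2)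
    * 4 ^+ k.*2)%R.
Proof.
move=> goodP; apply: le_trans (sum_subpolytope_edges_le _).
have le1 n : good n ->
    (a ^+ (\sum_i size (primes (n i))) <= #|@factorizations I N X (fun i => n i)|%:R)%R.
  move=> /goodP[sn en].
  have [|s [-> le_s]] := @card_factorizations I N X (fun i => n i) X0 _ sn en.
    by move=> i; rewrite -ltnS.
  by rewrite -mul2n exprM aN -natrX ler_nat.
apply: le_trans (ler_sum _ le1) _.
under eq_bigr do rewrite -sum1_card.
under [leRHS]eq_bigr do rewrite -natrX.
rewrite -!natr_sum ler_nat (leq_trans _ (card_subproducts (@incident I N) X0))//.
rewrite pair_big_dep/= sum1_card -(card_in_image (f := snd)).
  apply/subset_leq_card/fintype.subsetP => _ /fintype.imageP[[n g] /andP[_ /= gF] ->].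
  have [g0 gn] := elimT (factorizationsP _ _) gF.
  rewrite inE; apply/andP; split; first exact/forallP.
  by apply/forallP => i; rewrite gn -ltnS.
move=> [n g] [n' g'] /andP[_ /= gF] /andP[_ /= gF'] gg; subst g'.
have [_ gn] := elimT (factorizationsP _ _) gF.
have [_ gn'] := elimT (factorizationsP _ _) gF'.
by congr (_, _); apply/ffunP => i; apply/val_inj; rewrite /= -gn -gn'.
Qed.
End Count.

Local Open Scope classical_set_scope.
Local Open Scope ring_scope.

(** * The Hilbert-Schmidt norm *)

Section HilbertSchmidt.
Variable R : realType.

(** Lagrange's identity: twice the difference of the two sides is the sum of the squares (u x v y -
    u y v x)^2. *)
Lemma cauchy_schwarz_sum (T : finType) (u v : T -> R) :
  (\sum_x u x * v x) ^+ 2 <= (\sum_x u x ^+ 2) * (\sum_x v x ^+ 2).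
Proof.
have : 0 <= \sum_x \sum_y (u x * v y - u y * v x) ^+ 2.
  by apply: sumr_ge0 => x _; apply: sumr_ge0 => y _; exact: sqr_ge0.
have -> : \sum_x \sum_y (u x * v y - u y * v x) ^+ 2 =
    ((\sum_x u x ^+ 2) * (\sum_x v x ^+ 2) - (\sum_x u x * v x) ^+ 2) *+ 2.
  transitivity (\sum_x \sum_y (u x ^+ 2 * v y ^+ 2 + v x ^+ 2 * u y ^+ 2
                               - (u x * v x) * (u y * v y) *+ 2)).
    by apply: eq_bigr => x _; apply: eq_bigr => y _; ring.
  under eq_bigr do rewrite sumrB big_split/= sumrMnl -!mulr_sumr.
  rewrite sumrB big_split/= sumrMnl -!mulr_suml expr2 mulrnBl mulr2n.
  by congr (_ + _ - _); rewrite mulrC.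
by rewrite pmulrn_lge0// subr_ge0.
Qed.

Variable d : nat.
Implicit Types A B : 'M[R[i]]_d.

Definition coord A (x : 'I_d * 'I_d * bool) : R :=
  if x.2 then complex.Im (A x.1.1 x.1.2) else complex.Re (A x.1.1 x.1.2).

(** This is the real part of Tr(A^* B), the real inner product behind [hs_norm]. *)
Definition hs_dot A B := \sum_x coord A x * coord B x.

Lemma hs_norm_ge0 A : 0 <= hs_norm A. Proof. exact: sqrtr_ge0. Qed.

Lemma sum_coord (F : R -> R) A : \sum_x F (coord A x) =
  \sum_i \sum_j (F (complex.Re (A i j)) + F (complex.Im (A i j))).
Proof.
rewrite pair_big/= -(pair_bigA _ (fun ij b => F (coord A (ij, b))))/=.
apply: eq_bigr => -[i j] _; rewrite big_bool addrC. by [].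
Qed.

Lemma Re_sum (T : finType) (F : T -> R[i]) :
  complex.Re (\sum_x F x) = \sum_x complex.Re (F x).
Proof. by apply: (big_morph (@complex.Re R)) => // -[a b] [c e]. Qed.

Lemma Im_sum (T : finType) (F : T -> R[i]) :
  complex.Im (\sum_x F x) = \sum_x complex.Im (F x).
Proof. by apply: (big_morph (@complex.Im R)) => // -[a b] [c e]. Qed.

Lemma hs_norm_sqr A : hs_norm A ^+ 2 = \sum_x coord A x ^+ 2.
Proof.
rewrite (sum_coord (fun t => t ^+ 2)) exchange_big/=.
have E : complex.Re (\tr (adjoint_mx A *m A)) =
    \sum_j \sum_i (complex.Re (A i j) ^+ 2 + complex.Im (A i j) ^+ 2).
  rewrite Re_sum; apply: eq_bigr => j _; rewrite mxE Re_sum; apply: eq_bigr => i _.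
  by rewrite !mxE; case: (A i j) => a b /=; ring.
rewrite /hs_norm sqr_sqrtr E// sumr_ge0// => j _; rewrite sumr_ge0// => i _.
by rewrite addr_ge0 ?sqr_ge0.
Qed.

Lemma hs_dot_le A B : `|hs_dot A B| <= hs_norm A * hs_norm B.
Proof.
rewrite -ler_sqr ?nnegrE ?mulr_ge0 ?hs_norm_ge0// real_normK ?num_real//.
by rewrite exprMn !hs_norm_sqr; exact: cauchy_schwarz_sum.
Qed.

(** Cauchy-Schwarz bounds each squared entry of the product by the squared norm of a row of A times
    that of a column of B; the sum over rows and columns factors. *)
Lemma hs_normM A B : hs_norm (A *m B) <= hs_norm A * hs_norm B.
Proof.
rewrite -ler_sqr ?nnegrE ?mulr_ge0 ?hs_norm_ge0// exprMn.
pose q (z : R[i]) := complex.Re z ^+ 2 + complex.Im z ^+ 2.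
have nE (C : 'M[R[i]]_d) : hs_norm C ^+ 2 = \sum_i \sum_j q (C i j).
  by rewrite hs_norm_sqr (sum_coord (fun t => t ^+ 2)).
have qn z : q z = Normc.normc z ^+ 2.
  by case: z => a b; rewrite /= sqr_sqrtr// addr_ge0 ?sqr_ge0.
rewrite !nE mulr_suml; apply: ler_sum => i _.
rewrite [X in _ * X]exchange_big/= mulr_sumr; apply: ler_sum => j _.
have n_ge0 z : 0 <= Normc.normc z by case: z => a b; exact: sqrtr_ge0.
apply: (@le_trans _ _ ((\sum_k Normc.normc (A i k) * Normc.normc (B k j)) ^+ 2)).
  rewrite qn ler_sqr ?nnegrE ?sumr_ge0// ?mxE => [|k _]; last exact: mulr_ge0.
  under [leRHS]eq_bigr do rewrite -Normc.normcM.
  elim/big_ind2: _ => [|x y x' y' h h'|//]; first by rewrite Normc.normc0.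
  by apply: le_trans (le_normcD _ _) _; exact: lerD.
apply: le_trans (cauchy_schwarz_sum _ _) _.
by rewrite le_eqVlt; apply/orP; left; apply/eqP; congr (_ * _);
  apply: eq_bigr => k _; rewrite qn.
Qed.

Lemma coordZ_sign (b : bool) A x : coord ((-1) ^+ b *: A) x = (-1) ^+ b * coord A x.
Proof.
rewrite /coord !mxE; case: b; rewrite ?expr1 ?expr0 ?mulN1r ?mul1r//.
by case: x.2; case: (A _ _).
Qed.

Lemma coord_sum (T : finType) (F : T -> 'M[R[i]]_d) x :
  coord (\sum_v F v) x = \sum_v coord (F v) x.
Proof. by rewrite /coord summxE; case: x.2; rewrite ?Im_sum ?Re_sum. Qed.

Lemma hs_norm_sum_sqr (T : finType) (b : T -> bool) (A : T -> 'M[R[i]]_d) :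
  hs_norm (\sum_v (-1) ^+ b v *: A v) ^+ 2 =
  \sum_v \sum_w (-1) ^+ b v * (-1) ^+ b w * hs_dot (A v) (A w).
Proof.
rewrite hs_norm_sqr; under eq_bigr do rewrite expr2 !coord_sum big_distrlr/=.
rewrite exchange_big/=; apply: eq_bigr => v _.
rewrite exchange_big/=; apply: eq_bigr => w _.
rewrite mulr_sumr; apply: eq_bigr => x _; rewrite !coordZ_sign; ring.
Qed.

(** A squared norm is a double sum of inner products, so its k-th power expands over k pairs of
    indices; ['I_k * bool] numbers the entries of these pairs. Summing over s first isolates the
    signs, and [hs_dot_le] bounds each inner product. *)
Lemma sum_signs_hs_norm_le (S T : finType) (b : S -> T -> bool)
    (A : T -> 'M[R[i]]_d) k :
  \sum_s hs_norm (\sum_v (-1) ^+ b s v *: A v) ^+ (2 * k) <=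
  \sum_(n : {ffun 'I_k * bool -> T})
    `|\sum_s \prod_i (-1) ^+ b s (n i)| * \prod_i hs_norm (A (n i)).
Proof.
pose h (n : {ffun 'I_k * bool -> T}) : {ffun 'I_k -> T * T} :=
  [ffun i => (n (i, false), n (i, true))].
pose h' (phi : {ffun 'I_k -> T * T}) : {ffun 'I_k * bool -> T} :=
  [ffun x => if x.2 then (phi x.1).2 else (phi x.1).1].
have hK : cancel h h' by move=> n; apply/ffunP => -[i []]; rewrite !ffunE.
have h'K : cancel h' h.
  by move=> phi; apply/ffunP => i; rewrite !ffunE/=; case: (phi i).
pose c (vw : T * T) := hs_dot (A vw.1) (A vw.2).
pose e s (vw : T * T) : R := (-1) ^+ b s vw.1 * (-1) ^+ b s vw.2.
have prodE (F : T -> R) (n : {ffun 'I_k * bool -> T}) :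
    \prod_i F (n i) = \prod_i (F (h n i).1 * F (h n i).2).
  transitivity (\prod_i \prod_(j : bool) F (n (i, j))).
    by rewrite pair_bigA/=; apply: eq_bigr => -[].
  by apply: eq_bigr => i _; rewrite big_bool !ffunE mulrC.
have -> : \sum_s hs_norm (\sum_v (-1) ^+ b s v *: A v) ^+ (2 * k) =
    \sum_(n : {ffun 'I_k * bool -> T})
      (\sum_s \prod_i (-1) ^+ b s (n i)) * \prod_i c (h n i).
  transitivity (\sum_s \sum_(phi : {ffun 'I_k -> T * T})
    \prod_i (e s (phi i) * c (phi i))).
    apply: eq_bigr => s _; rewrite exprM hs_norm_sum_sqr pair_big/=.
    rewrite -[in LHS](card_ord k) -prodr_const bigA_distr_bigA/=.
    by apply: eq_bigr => phi _; apply: eq_bigr => i _; rewrite /e /c.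
  rewrite exchange_big/= (reindex h); last by exists h' => n _.
  apply: eq_bigr => n _; rewrite mulr_suml; apply: eq_bigr => s _.
  by rewrite (prodE (fun v => (-1) ^+ b s v)) big_split.
apply: ler_sum => n _; apply: le_trans (ler_norm _) _.
rewrite normrM ler_wpM2l// normr_prod (prodE (fun v => hs_norm (A v))).
apply: ler_prod => i _.
by rewrite normr_ge0 hs_dot_le.
Qed.

End HilbertSchmidt.

(** * Averaging over signs *)

(** Each factor is at most the largest one, y j, and y j ^+ #|I| is one of the summands. *)
Lemma prod_le_sum_expr (R : realDomainType) (I : finType) (y : I -> R) :
  (0 < #|I|)%N -> (forall i, 0 <= y i) -> \prod_i y i <= \sum_i y i ^+ #|I|.
Proof.
move=> /card_gt0P[i0 _] y0; pose j := [arg max_(i > i0) y i]%O.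
have yj i : y i <= y j by rewrite /j; case: arg_maxP => // j' _ H; exact: H.
apply: (@le_trans _ _ (y j ^+ #|I|)).
  by rewrite -prodr_const; apply: ler_prod => i _; rewrite y0 yj.
rewrite [leRHS](bigD1 j)//= lerDl sumr_ge0// => i _; exact: exprn_ge0.
Qed.

Section SignAverage.
Variables (R : realType) (d X : nat).
Local Notation V := 'I_X.+1.

Definition squarefree_pred (n : nat) : bool := (0 < n)%N && `[< squarefree n >].

(** A product of squarefree numbers is a square exactly when every prime divides an even number of
    them. Primes up to X suffice for entries at most X, by [square_tupleP]. *)
Definition square_tuple (I : finType) (n : I -> nat) :=
  [forall i, squarefree_pred (n i)] &&
  [forall p : V, prime p ==> ~~ odd #|[set i | (p %| n i)%N]%SET|].

Lemma square_tupleP (I : finType) (n : I -> nat) : (forall i, n i <= X)%N ->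
  square_tuple n -> (forall i, squarefree (n i)) /\
     (forall p, prime p -> ~~ odd #|[set i | (p %| n i)%N]%SET|).
Proof.
move=> nX /andP[/forallP sn /forallP en]; split=> [i|p pp].
  by have /andP[_ /asboolP] := sn i.
have [pX|pX] := ltnP p X.+1; first by have /implyP := en (Ordinal pX); exact.
rewrite (_ : [set i | _]%SET = finset.set0) ?cards0//.
apply/setP => i; rewrite !inE; apply/negbTE.
have /andP[n0 _] := sn i; apply: contraL pX => /(dvdn_leq n0) pn.
by rewrite -leqNgt; exact: leq_trans (nX i).
Qed.

(** The sign that f(v) acquires when each f(p) is multiplied by (-1)^(s p) is -1 to this power. *)
Definition sign_parity (s : {ffun V -> bool}) (v : nat) : bool :=
  \big[addb/false]_(p <- primes v) s (inord p).

Definition flip_sign (p : V) (s : {ffun V -> bool}) : {ffun V -> bool} :=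
  [ffun v => s v (+) (v == p)].

Lemma flip_signK p : involutive (flip_sign p).
Proof. by move=> s; apply/ffunP => v; rewrite !ffunE -addbA addbb addbF. Qed.

Lemma big_addb_mem (p : nat) (r : seq nat) : uniq r ->
  \big[addb/false]_(q <- r) (q == p) = (p \in r).
Proof.
elim: r => [|q r IH] /=; first by rewrite big_nil.
rewrite big_cons inE eq_sym => /andP[qr /IH ->].
by case: eqVneq qr => // -> /negbTE ->.
Qed.

Lemma sign_parity_flip (p : V) s v : (0 < v)%N -> (v <= X)%N -> prime p ->
  sign_parity (flip_sign p s) v = sign_parity s v (+) (p %| v)%N.
Proof.
move=> v0 vX pp; have -> : (p %| v)%N = (nat_of_ord p \in primes v).
  by rewrite mem_primes pp v0.
rewrite -big_addb_mem ?primes_uniq// /sign_parity -big_split/=.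
apply: eq_big_seq => q; rewrite mem_primes => /and3P[_ _ /(dvdn_leq v0) qv].
rewrite ffunE; congr (_ (+) _); rewrite -(inj_eq val_inj)/= inordK//.
by rewrite ltnS; exact: leq_trans qv vX.
Qed.

(** Flipping the sign at p permutes the sign patterns and negates every term. *)
Lemma sum_sign_parity_eq0 (I : finType) (n : I -> V) (p : V) :
  (forall i, 0 < n i)%N -> prime p -> odd #|[set i | (p %| n i)%N]%SET| ->
  \sum_s \prod_i (-1) ^+ sign_parity s (n i) = 0 :> R.
Proof.
move=> n0 pp odd_p; set S := \sum_s _.
have : S = - S.
  rewrite {1}/S (reindex_inj (inv_inj (flip_signK p))) -sumrN; apply: eq_bigr => s _.
  transitivity (\prod_i ((-1) ^+ sign_parity s (n i) * (-1) ^+ (p %| n i)%N : R)).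
    apply: eq_bigr => i _; rewrite sign_parity_flip// ?signr_addb//.
    by rewrite -ltnS.
  rewrite big_split/= -[RHS]mulrN1; congr (_ * _).
  transitivity ((-1) ^+ #|[set i | (p %| n i)%N]%SET| : R); last first.
    by rewrite -signr_odd odd_p.
  rewrite -prodr_const [RHS](big_mkcond)/=; apply: eq_bigr => i _.
  by rewrite inE; case: (p %| n i)%N; rewrite ?expr1 ?expr0.
by move/eqP; rewrite -addr_eq0 -mulr2n mulrn_eq0/= => /eqP.
Qed.

(** For a square tuple the sum of signs is at most the number of patterns. Any other tuple has a
    vanishing sum of signs or contains a zero matrix. *)
Lemma sign_average_le (k : nat) (A : V -> 'M[R[i]]_d) :
  (forall v : V, ~~ squarefree_pred v -> A v = 0) ->
  \sum_s hs_norm (\sum_(v : V) (-1) ^+ sign_parity s v *: A v) ^+ (2 * k) <=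
  #|{ffun V -> bool}|%:R *
  \sum_(n : {ffun 'I_k * bool -> V} | square_tuple (fun i => n i))
    \prod_i hs_norm (A (n i)).
Proof.
move=> A0; apply: le_trans (sum_signs_hs_norm_le _ _ _) _.
rewrite mulr_sumr [leRHS]big_mkcond/=; apply: ler_sum => n _.
have prod_ge0 : 0 <= \prod_i hs_norm (A (n i)).
  by apply: prodr_ge0 => i _; exact: hs_norm_ge0.
have [/forallP sn|/forallPn[i /A0 Ai0]] := boolP [forall i, squarefree_pred (n i)].
  case: ifPn => [_|].
    rewrite ler_wpM2r//; apply: le_trans (ler_norm_sum _ _ _) _.
    rewrite -sum1_card natr_sum; apply: ler_sum => s _.
    by rewrite normr_prod big1// => i _; rewrite normrX normrN1 expr1n.
  rewrite negb_and => /orP[/negP[]|]; first exact/forallP.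
  move=> /forallPn[p]; rewrite negb_imply negbK => /andP[pp op].
  rewrite (sum_sign_parity_eq0 _ pp op) ?normr0 ?mul0r// => i.
  by have /andP[] := sn i.
have A_i0 : hs_norm (A (n i)) = 0.
  apply/eqP; rewrite -sqrf_eq0 Ai0 hs_norm_sqr big1// => x _.
  by rewrite /coord !mxE/=; case: x.2; rewrite expr0n.
rewrite (bigD1 i)//= A_i0 mul0r mulr0; case: ifP => _ //.
Qed.
End SignAverage.

(** * Joint laws of independent families *)

Section CoordMeasurable.
Context (R : realType) (d : nat) (disp : measure_display) (S : measurableType disp).
Implicit Types G H : S -> 'M[R[i]]_d.

(** Real coordinates generate the Borel sets of matrices, so this form is equivalent to [random_mx]
    and gives access to the calculus of real measurable functions. *)
Definition coord_measurable G :=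
  forall x, measurable_fun [set: S] (fun s => coord (G s) x).

Lemma coord_measurable_random_mx G : coord_measurable G -> random_mx G.
Proof.
move=> mG; apply: (@measurability _ _ _ (mxBorel R d) _ _ (@mx_coord_sets R d)) => //.
move=> _ [U [i [j [B [mB [->|->]]]]] <-].
- by have := mG (i, j, false) measurableT _ mB; rewrite setTI.
- by have := mG (i, j, true) measurableT _ mB; rewrite setTI.
Qed.

Lemma random_mx_coord_measurable G : random_mx G -> coord_measurable G.
Proof.
move=> mG [[i j] b] _ B mB.
pose U : set (mxBorel R d) := [set A : 'M[R[i]]_d | B (coord A (i, j, b))].
have mU : measurable U.
  apply: sub_gen_smallest; exists i, j, B; split => //.
  by rewrite /U /coord; case: (b) => /=; [right|left].
by have := mG measurableT U mU.
Qed.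

Lemma coord_measurable_cst A : coord_measurable (fun=> A).
Proof. by move=> x; exact: measurable_cst. Qed.

Lemma coord_measurableM G H : coord_measurable G -> coord_measurable H ->
  coord_measurable (fun s => G s * H s).
Proof.
move=> mG mH [[i j] b].
(* The entries of the product have real part Re Re - Im Im and imaginary part Re Im + Im Re, each
   summed over l. *)
pose F1 b1 b2 s := \sum_l coord (G s) (i, l, b1) * coord (H s) (l, j, b2).
have mF b1 b2 : measurable_fun [set: S] (F1 b1 b2).
  by apply: measurable_sum => l; apply: measurable_funM.
case: b.
  rewrite (_ : (fun _ => _) = F1 false true \+ F1 true false).
    exact: measurable_funD.
  apply/funext => s /=; rewrite /F1 /coord/= mxE Im_sum -big_split/=.
  by apply: eq_bigr => l _; case: (G s i l) => u v; case: (H s l j).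
rewrite (_ : (fun _ => _) = F1 false false \- F1 true true).
  exact: measurable_funB.
apply/funext => s /=; rewrite /F1 /coord/= mxE Re_sum -sumrB/=.
by apply: eq_bigr => l _; case: (G s i l) => u v; case: (H s l j).
Qed.

Lemma coord_measurable_prod (I : Type) (r : seq I) (F : I -> S -> 'M[R[i]]_d) :
  (forall i, coord_measurable (F i)) ->
  coord_measurable (fun s => \prod_(i <- r) F i s).
Proof.
move=> mF; elim: r => [|i r IH].
  by under eq_fun do rewrite big_nil; exact: coord_measurable_cst.
by under eq_fun do rewrite big_cons; exact: coord_measurableM.
Qed.

Lemma coord_measurable_sum (I : finType) (F : I -> S -> 'M[R[i]]_d) :
  (forall i, coord_measurable (F i)) -> coord_measurable (fun s => \sum_i F i s).
Proof.
move=> mF x; under eq_fun do rewrite coord_sum.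
by apply: measurable_sum => i; exact: mF.
Qed.

Lemma coord_measurable_sign (b : bool) G : coord_measurable G ->
  coord_measurable (fun s => (-1) ^+ b *: G s).
Proof.
move=> mG x; under eq_fun do rewrite coordZ_sign.
by apply: measurable_funM => //; exact: measurable_cst.
Qed.

Lemma measurable_hs_norm G n : coord_measurable G ->
  measurable_fun [set: S] (fun s => hs_norm (G s) ^+ n).
Proof.
move=> mG; apply: measurable_funX.
rewrite (_ : (fun _ => _) = @Num.sqrt R \o (fun s => \sum_x coord (G s) x ^+ 2)).
  apply: measurableT_comp.
    exact: continuous_measurable_fun (@sqrt_continuous R).
  by apply: measurable_sum => x; exact: measurable_funX.
by apply/funext => s /=; rewrite -hs_norm_sqr sqrtr_sqr ger0_norm// hs_norm_ge0.
Qed.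
End CoordMeasurable.

Section JointLaw.
Context (R : realType) (d : nat) (K : finType).

Definition rectangles : set (set (K -> 'M[R[i]]_d)) :=
  [set U | exists B : K -> set (mxBorel R d),
     (forall i, measurable (B i)) /\ U = [set z | forall i, B i (z i)]].

Definition familyBorel := g_sigma_algebraType rectangles.

Lemma coord_measurable_eval (i : K) :
  coord_measurable (fun z : familyBorel => (z : K -> 'M[R[i]]_d) i).
Proof.
apply: random_mx_coord_measurable => _ B mB; rewrite setTI.
apply: sub_gen_smallest; exists (fun j => if j == i then B else setT); split.
  by move=> j; case: ifP.
apply/seteqP; split => z /=.
  by move=> Bz j; case: eqP => // ->.
by move=> /(_ i); rewrite eqxx.
Qed.

Definition independent_family (disp : measure_display) (T : measurableType disp)
    (P : probability T R) (U : K -> T -> 'M[R[i]]_d) :=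
  (forall i, random_mx (U i)) /\
  forall B : K -> set (mxBorel R d), (forall i, measurable (B i)) ->
    (P [set w | forall i, B i (U i w)] = \prod_i P (U i @^-1` B i))%E.

Lemma measurable_family (disp : measure_display) (T : measurableType disp)
    (U : K -> T -> 'M[R[i]]_d) : (forall i, random_mx (U i)) ->
  measurable_fun [set: T] (fun w => (U ^~ w) : familyBorel).
Proof.
move=> mU; apply: (@measurability _ _ _ familyBorel _ _ rectangles) => //.
move=> _ [_ [B [mB ->]] <-]; rewrite setTI.
rewrite (_ : _ @^-1` _ = \bigcap_(i in [set: K]) (U i @^-1` B i)).
  apply: fin_bigcap_measurable => [|i _]; first exact: finite_finset.
  by rewrite -[X in measurable X]setTI; exact: mU.
by apply/seteqP; split => w /= Bw i; [move=> _|]; exact: Bw.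
Qed.

(** Independence and equal marginals make the two joint laws agree on [rectangles], which are stable
    under intersection and generate [familyBorel]. Hence the laws coincide, and both expectations
    are integrals of F against them. *)
Lemma eq_expectation_family (disp : measure_display) (T : measurableType disp)
    (P : probability T R) (U : K -> T -> 'M[R[i]]_d)
    (disp' : measure_display) (T' : measurableType disp')
    (P' : probability T' R) (V : K -> T' -> 'M[R[i]]_d)
    (F : familyBorel -> R) :
  independent_family P U -> independent_family P' V ->
  (forall i, same_law P (U i) P' (V i)) ->
  measurable_fun setT F -> (forall z, 0 <= F z) ->
  ('E_P[fun w => F (U ^~ w)] = 'E_P'[fun w => F (V ^~ w)])%E.
Proof.
move=> [mU iU] [mV iV] UV mF F0; rewrite unlock.
have mU' := measurable_family mU; have mV' := measurable_family mV.
have mF' : measurable_fun setT (EFin \o F) by exact/measurable_EFinP.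
have FE0 z : (0 <= (EFin \o F) z)%E by rewrite lee_fin.
have := @ge0_integral_pushforward _ _ _ _ _ _ mU' P setT _ measurableT mF' (fun z _ => FE0 z).
have := @ge0_integral_pushforward _ _ _ _ _ _ mV' P' setT _ measurableT mF' (fun z _ => FE0 z).
rewrite !preimage_setT /= => <- <-.
apply: eq_measure_integral => A mA _.
refine (@measure_unique _ R familyBorel rectangles (fun=> setT) erefl _ _ _ _ _ _ _ _ mA).
- move=> _ _ [B [mB ->]] [C [mC ->]]; exists (fun i => B i `&` C i).
  split=> [i|]; first exact: measurableI.
  by apply/seteqP; split => z /= => [[Bz Cz] i|BCz]; split=> // i; case: (BCz i).
- move=> _; exists (fun=> setT); split => //.
  by apply/seteqP; split.
- by apply: bigcup_const; exists 0%N.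
- move=> _ [B [mB ->]]; rewrite /= /pushforward/=.
  transitivity (P' [set w | forall i, B i (V i w)]); last by [].
  transitivity (P [set w | forall i, B i (U i w)]); first by [].
  rewrite iU// iV//; apply: eq_bigr => i _; exact: UV.
- by move=> _; rewrite /= /pushforward /= preimage_setT probability_setT ltry.
Qed.
End JointLaw.

Lemma same_law_sym (R : realType) (d : nat)
    (disp : measure_display) (T : measurableType disp) (P : probability T R)
    (X : T -> 'M[R[i]]_d)
    (disp' : measure_display) (T' : measurableType disp') (P' : probability T' R)
    (X' : T' -> 'M[R[i]]_d) :
  same_law P X P' X' -> same_law P' X' P X.
Proof. by move=> XX' B mB; rewrite XX'. Qed.

Lemma same_law_trans (R : realType) (d : nat)
    (disp : measure_display) (T : measurableType disp) (P : probability T R)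
    (X : T -> 'M[R[i]]_d)
    (disp' : measure_display) (T' : measurableType disp') (P' : probability T' R)
    (X' : T' -> 'M[R[i]]_d)
    (disp2 : measure_display) (T2 : measurableType disp2) (P2 : probability T2 R)
    (X2 : T2 -> 'M[R[i]]_d) :
  same_law P X P' X' -> same_law P' X' P2 X2 -> same_law P X P2 X2.
Proof. by move=> XX' X'X2 B mB; rewrite XX'// X'X2. Qed.

Section Families.
Context (R : realType) (d : nat).
Context (disp0 : measure_display) (T0 : measurableType disp0) (P0 : probability T0 R).
Variable X : T0 -> 'M[R[i]]_d.

Lemma iid_copies_independent (disp : measure_display) (T : measurableType disp)
    (P : probability T R) (D : set nat) (Y : nat -> T -> 'M[R[i]]_d)
    (K : finType) (sg : K -> nat) :
  iid_copies P0 X P D Y -> injective sg -> (forall i, D (sg i)) ->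
  independent_family P (fun i => Y (sg i)).
Proof.
move=> [mY iY _] sg_inj Dsg; split=> [i|B mB]; first exact: mY.
(* Independence is stated for sets indexed by natural numbers, so B is transported along [sg] and
   completed by [setT]. *)
pose C n : set (mxBorel R d) := if [pick i | sg i == n] is Some i then B i else setT.
have CE i : C (sg i) = B i.
  rewrite /C; case: pickP => [j /eqP/sg_inj -> //|/(_ i)]; by rewrite eqxx.
have := iY [seq sg i | i <- enum K] C.
rewrite map_inj_uniq// enum_uniq => /(_ isT) H.
rewrite (_ : [set w | _] = \bigcap_(n in [set` [seq sg i | i <- enum K]]) (Y n @^-1` C n)).
  rewrite H.
  - by rewrite big_map big_enum/=; apply: eq_bigr => i _; rewrite CE.
  - by move=> _ /mapP[i _ ->].
  - by move=> n; rewrite /C; case: pickP => [i _|_]; [exact: mB|exact: measurableT].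
apply/seteqP; split => w /= Bw.
  by move=> _ /= /mapP[i _ ->]; rewrite CE; exact: Bw.
by move=> i; rewrite -CE; apply: (Bw (sg i)) => /=; rewrite map_f// mem_enum.
Qed.

Lemma random_mx_sign (disp : measure_display) (T : measurableType disp)
    (U : T -> 'M[R[i]]_d) (b : bool) :
  random_mx U -> random_mx (fun w => (-1) ^+ b *: U w).
Proof.
move=> mU; apply: coord_measurable_random_mx; apply: coord_measurable_sign.
exact: random_mx_coord_measurable.
Qed.

Lemma measurable_sign_preimage (b : bool) (B : set (mxBorel R d)) :
  measurable B -> measurable ((fun A : mxBorel R d => (-1) ^+ b *: A) @^-1` B).
Proof.
move=> mB; rewrite -[X in measurable X]setTI.
have mid : random_mx (idfun : mxBorel R d -> 'M[R[i]]_d) by exact: measurable_id.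
exact: (random_mx_sign b mid).
Qed.

Lemma independent_family_sign (disp : measure_display) (T : measurableType disp)
    (P : probability T R) (K : finType) (U : K -> T -> 'M[R[i]]_d) (b : K -> bool) :
  independent_family P U ->
  independent_family P (fun i w => (-1) ^+ b i *: U i w).
Proof.
move=> [mU iU]; split=> [i|B mB]; first exact: random_mx_sign.
rewrite (iU (fun i => (fun A : mxBorel R d => (-1) ^+ b i *: A) @^-1` B i))//.
by move=> i; exact: measurable_sign_preimage.
Qed.

(** The case b = true is the symmetry of X, transferred to U through the common law. *)
Lemma same_law_sign (disp : measure_display) (T : measurableType disp)
    (P : probability T R) (U : T -> 'M[R[i]]_d) (b : bool) :
  symmetric_mx P0 X -> same_law P U P0 X ->
  same_law P (fun w => (-1) ^+ b *: U w) P U.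
Proof.
move=> sX UX B mB.
rewrite [RHS]UX//.
transitivity (P0 (X @^-1` ((fun A : mxBorel R d => (-1) ^+ b *: A) @^-1` B))).
  by rewrite -UX//; exact: measurable_sign_preimage.
case: b; last by congr (P0 _); apply/seteqP; split => w /=; rewrite expr0 scale1r.
by rewrite [RHS]sX//; congr (P0 _); apply/seteqP; split => w /=; rewrite expr1 scaleN1r.
Qed.

(** A rectangle over [K1 + K2] is a product of a rectangle in each variable. This gives a model in
    which two blocks depend on separate sample points. *)
Lemma independent_family_prod (disp : measure_display) (T : measurableType disp)
    (P : probability T R) (K1 K2 : finType) (U1 : K1 -> T -> 'M[R[i]]_d)
    (U2 : K2 -> T -> 'M[R[i]]_d) :
  independent_family P U1 -> independent_family P U2 ->
  independent_family (P \x P)%E (fun (i : K1 + K2) (ww : T * T) =>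
    match i with inl i1 => U1 i1 ww.1 | inr i2 => U2 i2 ww.2 end).
Proof.
move=> [mU1 iU1] [mU2 iU2]; split=> [[i|i]|B mB].
- apply: (measurableT_comp (mU1 i)); exact: measurable_fst.
- apply: (measurableT_comp (mU2 i)); exact: measurable_snd.
have PP (A1 A2 : set T) : measurable A1 -> measurable A2 ->
    (((P \x P)%E : probability (T * T)%type R) (A1 `*` A2) = P A1 * P A2)%E.
  exact: product_measure1E.
have mR1 : measurable [set w | forall i, B (inl i) (U1 i w)].
  rewrite (_ : [set w | _] = \bigcap_(i in [set: K1]) (U1 i @^-1` B (inl i))).
    apply: fin_bigcap_measurable => [|i _]; first exact: finite_finset.
    by rewrite -[X in measurable X]setTI; exact: mU1.
  by apply/seteqP; split => w /= Bw i; [move=> _|]; exact: Bw.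
have mR2 : measurable [set w | forall i, B (inr i) (U2 i w)].
  rewrite (_ : [set w | _] = \bigcap_(i in [set: K2]) (U2 i @^-1` B (inr i))).
    apply: fin_bigcap_measurable => [|i _]; first exact: finite_finset.
    by rewrite -[X in measurable X]setTI; exact: mU2.
  by apply/seteqP; split => w /= Bw i; [move=> _|]; exact: Bw.
rewrite (_ : [set w | _] = [set w | forall i, B (inl i) (U1 i w)] `*`
                           [set w | forall i, B (inr i) (U2 i w)]); last first.
  apply/seteqP; split => [[w w']|[w w']] /=.
    by move=> Bw; split=> i; [exact: (Bw (inl i))|exact: (Bw (inr i))].
  by move=> [B1 B2] [i|i]; [exact: B1|exact: B2].
rewrite PP// big_sumType/= (iU1 (B \o inl)) ?(iU2 (B \o inr))//=;
  try by move=> i; exact: mB.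
congr (_ * _)%E; apply: eq_bigr => i _ /=.
  rewrite (_ : _ @^-1` _ = (U1 i @^-1` B (inl i)) `*` setT); last first.
    by apply/seteqP; split => [[w w']|[w w']] //= [].
  rewrite PP ?probability_setT ?mule1//.
  by rewrite -[X in measurable X]setTI; exact: mU1.
rewrite (_ : _ @^-1` _ = setT `*` (U2 i @^-1` B (inr i))); last first.
  by apply/seteqP; split => [[w w']|[w w']] //= [].
rewrite PP ?probability_setT ?mul1e//.
by rewrite -[X in measurable X]setTI; exact: mU2.
Qed.
End Families.

(** * Moments of products of independent copies *)

Lemma expectationE (R : realType) (disp : measure_display) (T : measurableType disp)
    (P : probability T R) (Z : T -> R) : ('E_P[Z] = \int[P]_w (Z w)%:E)%E.
Proof. by rewrite unlock. Qed.

Section Moments.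
Context (R : realType) (d : nat).
Context (disp0 : measure_display) (T0 : measurableType disp0) (P0 : probability T0 R).
Variable X : T0 -> 'M[R[i]]_d.
Context (disp1 : measure_display) (T1 : measurableType disp1) (P1 : probability T1 R).
Variable Y : nat -> T1 -> 'M[R[i]]_d.
Hypothesis hY : iid_copies P0 X P1 setT Y.
Variable q : nat.

Definition product_moment n : \bar R :=
  ('E_P1[fun w => (hs_norm (\prod_(i < n) Y i w) ^+ q)%R])%E.

Lemma product_moment_ge0 n : (0 <= product_moment n)%E.
Proof. by apply: expectation_ge0 => w; rewrite exprn_ge0// hs_norm_ge0. Qed.

Let mY i : coord_measurable (Y i).
Proof. by apply: random_mx_coord_measurable; case: hY => mY _ _; exact: mY. Qed.

Let mprod n : measurable_fun setT (fun w => hs_norm (\prod_(i < n) Y i w) ^+ q).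
Proof.
apply: measurable_hs_norm; apply: (coord_measurable_prod _ (F := fun i : 'I_n => Y i)).
by move=> i; exact: mY.
Qed.

Lemma same_law_copies i j : same_law P1 (Y i) P1 (Y j).
Proof.
case: hY => _ _ lY; apply: same_law_trans (lY i I) _.
by apply: same_law_sym; exact: lY.
Qed.

(* Realise the first m and the last n factors independently on T1 x T1. *)
Lemma product_moment_add m n :
  (product_moment (m + n) <= product_moment m * product_moment n)%E.
Proof.
pose K : finType := ('I_m + 'I_n)%type.
pose sg (i : K) : nat := match i with inl a => a | inr b => m + b end.
have sg_inj : injective sg.
  move=> [a|b] [a'|b'] /= e.
  - by congr inl; exact: val_inj.
  - by have := ltn_ord a; rewrite e ltnNge leq_addr.
  - by have := ltn_ord a'; rewrite -e ltnNge leq_addr.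
  - by congr inr; exact/val_inj/(addnI e).
pose F (z : familyBorel R d K) : R :=
  hs_norm ((\prod_(a < m) z (inl a)) * \prod_(b < n) z (inr b)) ^+ q.
pose U (i : K) := Y (sg i).
pose V (i : K) (ww : T1 * T1) :=
  match i with inl a => Y a ww.1 | inr b => Y b ww.2 end.
have iU : independent_family P1 U by exact: (iid_copies_independent hY).
have iV : independent_family (P1 \x P1)%E V.
  apply: (@independent_family_prod _ _ _ _ P1 _ _ (fun a : 'I_m => Y a)
    (fun b : 'I_n => Y b));
    apply: (iid_copies_independent hY) => //;
    exact: val_inj.
have UV i : same_law P1 (U i) (P1 \x P1)%E (V i).
  move=> B mB; have [mV' _] := iV.
  case: i => i /=; rewrite /U/= /V.
    rewrite (_ : (fun ww : T1 * T1 => Y i ww.1) @^-1` B = (Y i @^-1` B) `*` setT); last first.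
      by apply/seteqP; split => [[w w']|[w w']] //= [].
    transitivity (P1 (Y i @^-1` B) * P1 setT)%E; first by rewrite probability_setT mule1.
    apply/esym/product_measure1E => //; rewrite -[X in measurable X]setTI.
    by case: hY => mY' _ _; exact: mY'.
  rewrite (_ : (fun ww : T1 * T1 => Y i ww.2) @^-1` B = setT `*` (Y i @^-1` B)); last first.
    by apply/seteqP; split => [[w w']|[w w']] //= [].
  transitivity (P1 setT * P1 (Y i @^-1` B))%E.
    by rewrite probability_setT mul1e; exact: same_law_copies.
  apply/esym/product_measure1E => //; rewrite -[X in measurable X]setTI.
  by case: hY => mY' _ _; exact: mY'.
have mF : measurable_fun setT F.
  apply: measurable_hs_norm; apply: coord_measurableM.
    apply: (coord_measurable_prod _ (F := fun a (z : familyBorel R d K) => (z : K -> _) (inl a))).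
    by move=> a; exact: coord_measurable_eval.
  apply: (coord_measurable_prod _ (F := fun a (z : familyBorel R d K) => (z : K -> _) (inr a))).
  by move=> a; exact: coord_measurable_eval.
have := eq_expectation_family iU iV UV mF (fun z => exprn_ge0 _ (hs_norm_ge0 _)).
have -> : (fun w => F (U ^~ w)) = (fun w => hs_norm (\prod_(i < m + n) Y i w) ^+ q).
  by apply/funext => w; rewrite /F big_split_ord.
rewrite -/(product_moment (m + n)) => ->.
pose G (ww : T1 * T1) : \bar R := ((hs_norm (\prod_(i < m) Y i ww.1) ^+ q) *
  (hs_norm (\prod_(i < n) Y i ww.2) ^+ q))%:E.
have mG : measurable_fun setT G.
  apply/measurable_EFinP; apply: measurable_funM.
    exact: (measurableT_comp (mprod m) measurable_fst).
  exact: (measurableT_comp (mprod n) measurable_snd).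
have G0 ww : (0 <= G ww)%E by rewrite lee_fin mulr_ge0 ?exprn_ge0 ?hs_norm_ge0.
(* [hs_normM] separates the two sample points in the integrand; Tonelli's theorem then factors the
   integral. *)
apply: (@le_trans _ _ (\int[(P1 \x P1)%E]_ww G ww)%E).
  rewrite expectationE; apply: ge0_le_integral => //.
  - by move=> ww _; rewrite lee_fin exprn_ge0 ?hs_norm_ge0.
  - apply/measurable_EFinP; apply: (measurableT_comp mF); apply: measurable_family.
    by case: iV.
  - move=> ww _; rewrite lee_fin -exprMn.
    by rewrite lerXn2r ?nnegrE ?mulr_ge0 ?hs_norm_ge0// hs_normM.
rewrite fubini_tonelli1// /fubini_F/=.
rewrite (eq_integral (fun w =>
    (hs_norm (\prod_(i < m) Y i w) ^+ q)%:E * product_moment n)%E); last first.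
  move=> w _; rewrite /product_moment expectationE /G/=.
  under eq_integral => w' _ do rewrite EFinM.
  rewrite ge0_integralZl//=.
  - by apply/measurable_EFinP; exact: mprod.
  - by move=> w' _; rewrite lee_fin exprn_ge0 ?hs_norm_ge0.
  - by rewrite lee_fin exprn_ge0 ?hs_norm_ge0.
rewrite ge0_integralZr//=.
- by rewrite /product_moment !expectationE.
- by apply/measurable_EFinP; exact: mprod.
- by move=> w' _; rewrite lee_fin exprn_ge0 ?hs_norm_ge0.
- exact: product_moment_ge0.
Qed.

(** Only the number of factors matters: distinct indices give independent copies, with the joint law
    of the first [size s] terms of Y. *)
Lemma expectation_copy (disp : measure_display) (T : measurableType disp)
    (P : probability T R) (U : nat -> T -> 'M[R[i]]_d) (D : set nat) (s : seq nat) :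
  iid_copies P0 X P D U -> uniq s -> (forall n, n \in s -> D n) ->
  ('E_P[fun w => (hs_norm (\prod_(n <- s) U n w) ^+ q)%R] =
   product_moment (size s))%E.
Proof.
move=> hU us sD.
pose K : finType := 'I_(size s).
pose F (z : familyBorel R d K) : R := hs_norm (\prod_(a < size s) z a) ^+ q.
have nth_s (i : K) : nth 0%N s i \in s by rewrite mem_nth.
have iU : independent_family P (fun i : K => U (nth 0%N s i)).
  apply: (iid_copies_independent hU) => [i j /eqP|i]; last exact/sD/nth_s.
  by rewrite nth_uniq// => /eqP/val_inj.
have iY : independent_family P1 (fun i : K => Y i).
  by apply: (iid_copies_independent hY) => //; exact: val_inj.
have UY (i : K) : same_law P (U (nth 0%N s i)) P1 (Y i).
  case: hU => _ _ lU; case: hY => _ _ lY.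
  apply: same_law_trans (lU _ (sD _ (nth_s i))) _.
  by apply: same_law_sym; exact: lY.
have mF : measurable_fun setT F.
  apply: measurable_hs_norm.
  apply: (coord_measurable_prod _ (F := fun a (z : familyBorel R d K) => (z : K -> _) a)).
  by move=> a; exact: coord_measurable_eval.
have := eq_expectation_family iU iY UY mF (fun z => exprn_ge0 _ (hs_norm_ge0 _)).
rewrite /F => E; rewrite /product_moment -E; congr ('E_P[_])%E.
by apply/funext => w; rewrite (big_nth 0%N) big_mkord.
Qed.

(** Deterministic sign changes preserve the joint law of independent symmetric copies, hence the law
    of any measurable function H of them. *)
Lemma expectation_sign_invariant (disp : measure_display) (T : measurableType disp)
    (P : probability T R) (U : nat -> T -> 'M[R[i]]_d) (D : set nat)
    (K : finType) (sg : K -> nat) (H : (K -> 'M[R[i]]_d) -> 'M[R[i]]_d)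
    (b : K -> bool) :
  symmetric_mx P0 X -> iid_copies P0 X P D U -> injective sg ->
  (forall i, D (sg i)) -> coord_measurable (H : familyBorel R d K -> _) ->
  ('E_P[fun w => (hs_norm (H (fun i => ((-1) ^+ b i *: U (sg i) w)%R)) ^+ q)%R] =
   'E_P[fun w => (hs_norm (H (fun i => U (sg i) w)) ^+ q)%R])%E.
Proof.
move=> sX hU sg_inj Dsg mH.
have iU := iid_copies_independent hU sg_inj Dsg.
have iU' := independent_family_sign b iU.
apply: (eq_expectation_family (F := fun z => hs_norm (H z) ^+ q) iU' iU).
- by move=> i; apply: same_law_sign sX _; case: hU => _ _ lU; exact: lU.
- exact: measurable_hs_norm.
- by move=> z; rewrite exprn_ge0 ?hs_norm_ge0.
Qed.
End Moments.

(** * Growth of the moments of products *)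

Section Fekete.
Variables (R : realType) (A : nat -> R) (s : R).
Hypotheses (s0 : 0 < s) (A0 : forall n, 0 <= A n).
Hypothesis A_add : forall m n, A (m + n)%N <= A m * A n.

Definition nth_root_seq n := A n `^ (s * n%:R)^-1.

Lemma nth_root_seqK n : (0 < n)%N -> nth_root_seq n `^ (s * n%:R) = A n.
Proof.
move=> n0; have sn0 : s * n%:R != 0 by rewrite mulf_neq0 ?gt_eqF ?ltr0n.
by rewrite /nth_root_seq -powRrM mulVf// powRr1.
Qed.

Lemma nth_root_seq_le n t : (0 < n)%N -> 0 <= t ->
  (nth_root_seq n <= t) = (A n <= t `^ (s * n%:R)).
Proof.
move=> n0 t0; have sn0 : 0 < s * n%:R by rewrite mulr_gt0 ?ltr0n.
rewrite -(nth_root_seqK n0); apply/idP/idP => [|].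
  by move=> ut; rewrite ge0_ler_powR ?nnegrE ?powR_ge0// ltW.
apply: contraTT; rewrite -!ltNge => tu.
by rewrite gt0_ltr_powR ?nnegrE ?powR_ge0.
Qed.

Lemma submult_iter m q r : A (q * m + r)%N <= A m ^+ q * A r.
Proof.
elim: q => [|q IH]; first by rewrite mul0n add0n expr0 mul1r.
rewrite mulSn -addnA exprS -mulrA; apply: le_trans (A_add _ _) _.
exact: ler_wpM2l.
Qed.

(** Bernoulli's inequality: c^n >= 1 + n (c - 1). *)
Lemma near_le_exprn (c K : R) : 1 < c -> \forall n \near \oo, K <= c ^+ n.
Proof.
move=> c1; have c10 : 0 < c - 1 by rewrite subr_gt0.
have B n : 1 + n%:R * (c - 1) <= c ^+ n.
  elim: n => [|n IH]; first by rewrite mul0r addr0 expr0.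
  rewrite exprS; apply: le_trans (ler_wpM2l (ltW (lt_trans ltr01 c1)) IH).
  have : 0 <= n%:R * (c - 1) ^+ 2 by rewrite mulr_ge0// sqr_ge0.
  by rewrite -natr1; nra.
near=> n; apply: le_trans (B n).
have : (K - 1) / (c - 1) <= n%:R by near: n; exact: nbhs_infty_ger.
rewrite ler_pdivrMr//; lra.
Unshelve. all: by end_near. Qed.

(** Fekete's argument without logarithms, so that A n = 0 is allowed: the limit is the infimum of
    the terms with n > 0. *)
Lemma nth_root_seq_cvg : cvgn nth_root_seq.
Proof.
(* The index 0 is left out: its exponent is 0^-1 = 0, so its term is 1 whatever A is. *)
pose S := [set nth_root_seq n | n in [set n | (0 < n)%N]].
have S_lb : has_lbound S by exists 0 => _ [n _ <-]; exact: powR_ge0.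
have S_inf : has_inf S by split => //; exists (nth_root_seq 1), 1%N.
have L0 : 0 <= inf S.
  by apply: lb_le_inf; [case: S_inf|move=> _ [n _ <-]; exact: powR_ge0].
apply/cvg_ex; exists (inf S); apply/cvgrPdist_le => e e0.
have [_ [m m0 <-] um] := inf_adherent (divr_gt0 e0 (ltr0Sn R 1)) S_inf.
(* Half of e keeps t positive even if the infimum is 0, and leaves a ratio (inf S + e) / t above
   1. *)
set t := inf S + e / 2 in um.
have t0 : 0 < t by rewrite ltr_wpDl// divr_gt0.
have Am : A m <= t `^ (s * m%:R) by rewrite -nth_root_seq_le// ltW.
(* K absorbs the remainder of n modulo m, uniformly in n. *)
pose K := \sum_(r < m) A r / t `^ (s * r%:R).
have AK n : A n <= K * t `^ (s * n%:R).
  rewrite {1}(divn_eq n m); apply: le_trans (submult_iter _ _ _) _.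
  have rm : (n %% m < m)%N by rewrite ltn_mod.
  have -> : t `^ (s * n%:R) = (t `^ (s * m%:R)) ^+ (n %/ m) * t `^ (s * (n %% m)%:R).
    rewrite -powR_mulrn ?powR_ge0// -powRrM -powRD; last by rewrite (gt_eqF t0) implybT.
    congr (_ `^ _); rewrite -mulrA -mulrDr; congr (_ * _).
    by rewrite -natrM -natrD mulnC -divn_eq.
  rewrite mulrCA; apply: ler_pM => //; first exact: exprn_ge0.
    by rewrite lerXn2r ?nnegrE ?powR_ge0.
  rewrite -ler_pdivrMr ?powR_gt0// /K (bigD1 (Ordinal rm))//= lerDl.
  by rewrite sumr_ge0// => r _; rewrite divr_ge0 ?powR_ge0.
(* The target (inf S + e)^(s n) exceeds t^(s n) by the factor c^n, which eventually outgrows K. *)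
pose c := ((inf S + e) / t) `^ s.
have c1 : 1 < c.
  have -> : 1 = 1 `^ s by rewrite powR1.
  have Le : 0 <= inf S + e by rewrite addr_ge0// ltW.
  rewrite gt0_ltr_powR ?nnegrE ?divr_ge0 ?(ltW t0)//.
  by rewrite ltr_pdivlMr// mul1r /t; lra.
near=> n.
have n0 : (0 < n)%N by near: n; exact: nbhs_infty_gt.
rewrite distrC ger0_norm ?subr_ge0; last by apply: ge_inf => //; exists n.
rewrite lerBlDl nth_root_seq_le ?addr_ge0 ?(ltW e0)//.
apply: le_trans (AK n) _.
have -> : inf S + e = (inf S + e) / t * t by rewrite divfK ?gt_eqF.
rewrite powRM ?(ltW t0)//; last first.
  by apply: divr_ge0; [exact: addr_ge0 L0 (ltW e0)|exact: ltW].
rewrite ler_wpM2r ?powR_ge0// powRrM powR_mulrn ?powR_ge0//.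
by near: n; exact: near_le_exprn.
Unshelve. all: by end_near. Qed.

Lemma growth_le (a : R) : limn nth_root_seq < a -> 1 <= a ->
  exists C, forall n, A n <= C * a `^ (s * n%:R).
Proof.
move=> La a1.
have [n0 _ Hn0] : \forall n \near \oo, nth_root_seq n <= a.
  exact: (cvgr_le _ nth_root_seq_cvg _ La).
have a_ge1 n : 1 <= a `^ (s * n%:R).
  rewrite -[X in X <= _](powRr0 a); apply: ler_powR => //.
  by rewrite mulr_ge0// ltW.
(* For n > n0 the summand 1 suffices; for n <= n0 the sum dominates A n, as a^(s n) >= 1. *)
exists (1 + \sum_(n < n0.+1) A n) => n.
have sum0 : 0 <= \sum_(n < n0.+1) A n by apply: sumr_ge0.
have [n0n|nn0] := ltnP n0 n.
  have : A n <= a `^ (s * n%:R).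
    rewrite -nth_root_seq_le ?(leq_ltn_trans _ n0n)// ?(le_trans ler01)//.
    by apply: Hn0 => /=; exact: ltnW.
  move=> /le_trans; apply; by rewrite ler_peMl ?powR_ge0// lerDl.
rewrite -[X in X <= _]mulr1; apply: ler_pM => //.
rewrite (bigD1 (Ordinal (nn0 : n < n0.+1)%N))//= addrCA lerDl addr_ge0//.
exact: sumr_ge0.
Qed.
End Fekete.

Lemma prod_sign_scale (R : realType) (d : nat) (r : seq nat) (b : nat -> bool)
    (U : nat -> 'M[R[i]]_d) :
  \prod_(p <- r) ((-1) ^+ b p *: U p) =
  (-1) ^+ (\big[addb/false]_(p <- r) b p) *: \prod_(p <- r) U p.
Proof.
elim: r => [|p r IH]; first by rewrite !big_nil expr0 scale1r.
rewrite !big_cons IH signr_addb -scalerA.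
by rewrite -[LHS]/(_ *m _) -scalemxAl -scalemxAr.
Qed.

Section MomentBounds.
Context (R : realType) (d k : nat).
Context (disp0 : measure_display) (T0 : measurableType disp0) (P0 : probability T0 R).
Variable X : T0 -> 'M[R[i]]_d.
Hypothesis hX : random_mx X.

(** Convergence to 0 makes the truncated expectation finite at some r >= 0, and Z <= r + Z 1(Z > r)
    for Z >= 0. *)
Lemma expectation_lt_pinfty_of_truncation q :
  'E_P0[fun w => (hs_norm (X w) ^+ q
      * \1_[set w' | r < hs_norm (X w') ^+ q] w)%R]%E @[r --> +oo] --> 0%E ->
  ('E_P0[fun w => (hs_norm (X w) ^+ q)%R] < +oo)%E.
Proof.
have mXq : measurable_fun setT (fun w => hs_norm (X w) ^+ q).
  by apply: measurable_hs_norm; exact: random_mx_coord_measurable.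
move=> /fine_cvgP[Hfin _].
have : \forall r \near +oo%R, (0 : R) <= r by apply: nbhs_pinfty_ge; exact: num_real.
move=> /(filterI Hfin) /filter_ex[r /= [Efin r0]].
have mS : measurable [set w' | r < hs_norm (X w') ^+ q].
  rewrite (_ : [set w' | _] = setT `&` (fun w => hs_norm (X w) ^+ q) @^-1` `]r, +oo[).
    exact: mXq.
  by apply/seteqP; split => w /=; rewrite in_itv/= andbT => // -[].
set Z := (fun w => _) in Efin.
have mZ : measurable_fun setT Z.
  by apply: measurable_funM => //; exact: measurable_indic.
have Z0 w : 0 <= Z w by rewrite mulr_ge0// exprn_ge0// hs_norm_ge0.
apply: (@le_lt_trans _ _ (r%:E + 'E_P0[Z])%E); last first.
  by rewrite lte_add_pinfty// ?ltry// ltey_eq Efin.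
have -> : (r%:E = 'E_P0[cst r])%E by rewrite expectation_cst.
rewrite !expectationE -ge0_integralD//.
- apply: ge0_le_integral => //.
  + by move=> w _; rewrite lee_fin exprn_ge0 ?hs_norm_ge0.
  + exact/measurable_EFinP.
  + by apply: emeasurable_funD => //; exact/measurable_EFinP.
  + move=> w _; rewrite -EFinD lee_fin /Z /= indicE.
    have [wS|] := boolP (w \in _).
      by rewrite mulr1 lerDr.
    by rewrite notin_setE/= mulr0 addr0 => /negP; rewrite -leNgt.
- exact/measurable_EFinP.
- by move=> w _; rewrite lee_fin Z0.
- exact/measurable_EFinP.
Qed.

Context (disp1 : measure_display) (T1 : measurableType disp1) (P1 : probability T1 R).
Variable Y : nat -> T1 -> 'M[R[i]]_d.
Hypothesis hY : iid_copies P0 X P1 setT Y.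

(* Lets [expectation_copy] be applied to X itself. *)
Lemma single_copy : iid_copies P0 X P0 [set 0%N] (fun=> X).
Proof.
split=> [n _|s B us s0 mB|n _] //.
case: s us s0 => [|n [|m s]] us s0.
- by rewrite set_nil bigcap_set0 big_nil probability_setT.
- by rewrite set_cons1 bigcap_set1 big_seq1.
- have n0 := s0 n (mem_head _ _); have m0 : m = 0%N.
    by apply: s0; rewrite !inE eqxx orbT.
  by move: us; rewrite n0 m0.
Qed.

Hypothesis k0 : (0 < k)%N.
Hypothesis X_fin : ('E_P0[fun w => (hs_norm (X w) ^+ (2 * k))%R] < +oo)%E.

Lemma product_moment_fin_num n : product_moment P1 Y (2 * k) n \is a fin_num.
Proof.
rewrite ge0_fin_numE ?product_moment_ge0//.
elim: n => [|n IH].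
  rewrite /product_moment; under eq_fun do rewrite big_ord0.
  by rewrite expectation_cst ltry.
have H := product_moment_add hY (2 * k) n 1.
have {}H : (product_moment P1 Y (2 * k) n.+1 <=
    product_moment P1 Y (2 * k) n * product_moment P1 Y (2 * k) 1)%E.
  by move: H; rewrite (addn1 n).
apply: (le_lt_trans H).
apply: lte_mul_pinfty.
- exact: product_moment_ge0.
- by rewrite ge0_fin_numE //; exact: product_moment_ge0.
have E := @expectation_copy _ _ _ _ _ _ _ _ _ _ hY (2 * k) _ _ _ _ _ [:: 0%N] single_copy.
rewrite -E//.
  by under eq_fun do rewrite big_seq1.
by move=> n0; rewrite inE => /eqP ->.
Qed.

(** The integer N = [rho^2 + 1] strictly exceeds rho^2, so [growth_le] applies at the rate sqrt N;
    at the rate rho itself the limit alone would give no constant. *)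
Lemma product_moment_growth : exists (N : nat) (C : R),
  [/\ (0 < N)%N, Num.floor (spectral_radius P1 Y (2 * k)%:R ^+ 2 + 1) = N%:Z,
      0 <= C & forall n, (product_moment P1 Y (2 * k) n <=
        (C * Num.sqrt N%:R ^+ (2 * k * n))%:E)%E].
Proof.
set rho := spectral_radius _ _ _.
pose A n := fine (product_moment P1 Y (2 * k) n).
pose s : R := (2 * k)%:R.
have s0 : 0 < s by rewrite ltr0n muln_gt0.
have A0 n : 0 <= A n by rewrite fine_ge0 ?product_moment_ge0.
have A_add m n : A (m + n)%N <= A m * A n.
  rewrite -fineM ?product_moment_fin_num// fine_le ?fin_numM ?product_moment_fin_num//.
  exact: product_moment_add hY _ _ _.
have rhoE : rho = limn (nth_root_seq A s).
  rewrite /rho /spectral_radius; congr (limn _); apply/funext => n.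
  rewrite /nth_root_seq /A /product_moment; congr (fine 'E_P1[_] `^ _).
  by apply/funext => w; rewrite powR_mulrn ?hs_norm_ge0.
have rho0 : 0 <= rho.
  rewrite rhoE; apply: limr_ge; first exact: nth_root_seq_cvg.
  by apply: nearW => n; exact: powR_ge0.
have := floor_itv (rho ^+ 2 + 1).
have : 1 <= Num.floor (rho ^+ 2 + 1) :> int.
  by rewrite floor_ge_int lerDr sqr_ge0.
case: (Num.floor _) => [N|//] N1 /andP[_ ltN].
have a1 : 1 <= Num.sqrt N%:R :> R by rewrite -[leLHS]sqrtr1 ler_wsqrtr // ler1n.
have rho_lt : rho < Num.sqrt N%:R.
  rewrite -ltr_sqr ?nnegrE ?sqrtr_ge0// sqr_sqrtr//.
  by move: ltN; rewrite intrD ltrD2r.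
have [C AC] := growth_le s0 A0 A_add (eq_ind _ (fun r => r < _) rho_lt _ rhoE) a1.
exists N, C; split => //.
(* The bound at n = 0 reads A 0 <= C. *)
- by apply: le_trans (A0 0%N) _; have := AC 0%N; rewrite mulr0 powRr0 mulr1.
- move=> n; rewrite -[leLHS]fineK ?product_moment_fin_num// lee_fin.
  by apply: le_trans (AC n) _; rewrite -natrM powR_mulrn// sqrtr_ge0.
Qed.

End MomentBounds.

(** * From the moment of the sum to a sum over square tuples *)

Section SquareTupleBound.
Context (R : realType) (d k X : nat) (a C : R).
Context (disp0 : measure_display) (T0 : measurableType disp0) (P0 : probability T0 R).
Variable X0 : T0 -> 'M[R[i]]_d.
Hypothesis sX : symmetric_mx P0 X0.
Context (disp : measure_display) (T : measurableType disp) (P : probability T R).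
Variable f : nat -> T -> 'M[R[i]]_d.
Hypothesis hf : random_mult_fun P0 X0 P f.
Hypotheses (k0 : (0 < k)%N) (a0 : 0 < a).
Hypothesis f_moment : forall v, squarefree v ->
  ('E_P[fun w => (hs_norm (f v w) ^+ (2 * k))%R] <=
    (C * a ^+ (2 * k * size (primes v)))%:E)%E.
Local Notation V := 'I_X.+1.
Local Notation tuples := {ffun 'I_k * bool -> V}.

(** Vanishes off the squarefree indices, in particular at 0, where f is unconstrained. *)
Let g (v : V) (w : T) := if squarefree_pred v then f v w else 0.

Let f_prime_measurable p : prime p -> coord_measurable (f p).
Proof.
by case: hf => _ [mf _ _] _ pp; apply: random_mx_coord_measurable; exact: mf.
Qed.

Let f_measurable v : squarefree v -> coord_measurable (f v).
Proof.
case: hf => _ _ fprod sv.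
rewrite (_ : f v = fun w => \prod_(i < size (primes v)) f (nth 0%N (primes v) i) w).
  apply: coord_measurable_prod => i; apply: f_prime_measurable.
  have : nth 0%N (primes v) i \in primes v by rewrite mem_nth.
  by rewrite mem_primes => /andP[].
by apply/funext => w; rewrite fprod// (big_nth 0%N) big_mkord.
Qed.

Let sum_g w : \sum_(1 <= n < X.+1) f n w = \sum_v g v w.
Proof.
rewrite -(big_mkord xpredT (fun v => if squarefree_pred v then f v w else 0)).
rewrite [RHS]big_ltn//= add0r; apply: eq_big_nat => n /andP[n0 _].
rewrite /squarefree_pred n0/=; case: asboolP => // sn.
by case: hf => f0 _ _; rewrite f0.
Qed.

Let K := {p : V | prime p}.
(* The value 1 is never used: only primes p <= X occur. *)
Let ext (z : K -> 'M[R[i]]_d) (p : nat) : 'M[R[i]]_d :=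
  if [pick i : K | val (val i) == p :> nat] is Some i then z i else 1.
(** The whole sum as a function of the values at the primes alone, the form that
    [expectation_sign_invariant] applies to. *)
Let H (z : K -> 'M[R[i]]_d) :=
  \sum_(v : V) if squarefree_pred v then \prod_(p <- primes v) ext z p else 0.

Let H_measurable : coord_measurable (H : familyBorel R d K -> _).
Proof.
apply: coord_measurable_sum => v.
case: (squarefree_pred v); last exact: coord_measurable_cst.
apply: coord_measurable_prod => p; rewrite /ext; case: (pick _) => [i|].
  exact: coord_measurable_eval.
exact: coord_measurable_cst.
Qed.

Let HE (F : nat -> 'M[R[i]]_d) : H (fun i => F (val (val i))) =
  \sum_(v : V) if squarefree_pred v then \prod_(p <- primes v) F p else 0.
Proof.
apply: eq_bigr => v _; case: ifP => // /andP[v0 _]; apply: eq_big_seq => p.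
rewrite mem_primes => /and3P[pp _ /(dvdn_leq v0) pv].
have pX : (p < X.+1)%N by rewrite (leq_ltn_trans pv).
rewrite /ext; case: pickP => [i /eqP -> //|/(_ (Sub (Ordinal pX) pp))].
by rewrite /= eqxx.
Qed.

(** By [prod_sign_scale], signs attached to the f(p) come out of the product over the primes of v as
    [sign_parity s v]. *)
Let sign_invariant (s : {ffun V -> bool}) :
  ('E_P[fun w => (hs_norm (\sum_(v : V) (-1) ^+ sign_parity s v *: g v w) ^+ (2 * k))%R] =
   'E_P[fun w => (hs_norm (\sum_v g v w) ^+ (2 * k))%R])%E.
Proof.
case: hf => _ iid_f fprod.
have sg_inj : injective (fun i : K => val (val i) : nat).
  by move=> i j /val_inj/val_inj.
have E := expectation_sign_invariant (2 * k) (fun i : K => s (val i)) sX iid_f sg_inj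
  (fun i => valP i) H_measurable.
have gE w : \sum_v g v w = H (fun i : K => f (val (val i)) w).
  rewrite (HE (fun p => f p w)).
  apply: eq_bigr => v _; rewrite /g; case: ifP => // /andP[_ /asboolP sv].
  by rewrite fprod.
have sgE w : \sum_(v : V) (-1) ^+ sign_parity s v *: g v w =
    H (fun i : K => (-1) ^+ s (val i) *: f (val (val i)) w).
  transitivity (H (fun i : K => (-1) ^+ s (inord (val (val i))) *: f (val (val i)) w)).
    rewrite (HE (fun p => (-1) ^+ s (inord p) *: f p w)).
    apply: eq_bigr => v _; rewrite /g; case: ifP => [/andP[_ /asboolP sv]|_].
      rewrite (fprod v sv w) /sign_parity.
      exact: esym (prod_sign_scale _ (fun p => s (inord p)) (fun p => f p w)).
    by rewrite scaler0.
  by congr H; apply/funext => i; rewrite inord_val.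
have congrE (G1 G2 : T -> 'M[R[i]]_d) : (forall w, G1 w = G2 w) ->
  ('E_P[fun w => (hs_norm (G1 w) ^+ (2 * k))%R] =
   'E_P[fun w => (hs_norm (G2 w) ^+ (2 * k))%R])%E.
  by move=> /funext ->.
exact: (etrans (congrE _ _ sgE) (etrans E (esym (congrE _ _ gE)))).
Qed.

(** Normalised so that, by [f_moment], its expectation is at most C for every squarefree v. *)
Let h (v : nat) (w : T) : R := if squarefree_pred v then
  hs_norm (f v w) ^+ (2 * k) / a ^+ (2 * k * size (primes v)) else 0.

Let h_ge0 v w : 0 <= h v w.
Proof.
by rewrite /h; case: ifP => // _; rewrite divr_ge0 ?exprn_ge0 ?hs_norm_ge0// ltW.
Qed.

(* Bounding a product by the sum of the powers replaces Hoelder's inequality. *)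
Let pointwise_le w :
  \sum_(s : {ffun V -> bool})
    hs_norm (\sum_(v : V) (-1) ^+ sign_parity s v *: g v w) ^+ (2 * k) <=
  #|{ffun V -> bool}|%:R * \sum_(n : tuples | square_tuple X (fun i => n i))
    a ^+ (\sum_i size (primes (n i))) * \sum_i h (n i) w.
Proof.
apply: le_trans (@sign_average_le R d X k (fun v => g v w) _) _.
  by move=> v /negbTE; rewrite /g => ->.
rewrite ler_wpM2l//; apply: ler_sum => n /andP[/forallP sn _].
pose y i := hs_norm (f (n i) w) / a ^+ size (primes (n i)).
have y0 i : 0 <= y i by rewrite divr_ge0 ?hs_norm_ge0 ?exprn_ge0 ?ltW.
have Ik : #|{: 'I_k * bool}| = (2 * k)%N.
  by rewrite card_prod card_ord card_bool mulnC.
rewrite (_ : \prod_i _ = a ^+ (\sum_i size (primes (n i))) * \prod_i y i).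
  rewrite ler_wpM2l ?exprn_ge0 ?(ltW a0)//.
  apply: le_trans (prod_le_sum_expr _ y0) _; first by rewrite Ik muln_gt0.
  rewrite Ik; apply: ler_sum => i _.
  by rewrite /y /h sn expr_div_n -exprM [(size _ * _)%N]mulnC.
rewrite expr_sum -big_split/=; apply: eq_bigr => i _.
by rewrite /g sn mulrC divfK// expf_neq0// gt_eqF.
Qed.

(** All B sign patterns give the same expectation, so B times the moment is the integral of the left
    side of [pointwise_le]. On the right, each square tuple contributes 2k terms h of expectation at
    most C. *)
Lemma multiplicative_moment_le :
  ('E_P[fun w => (hs_norm (\sum_(1 <= n < X.+1) f n w) ^+ (2 * k))%R] <=
   (C * (2 * k)%:R * \sum_(n : tuples | square_tuple X (fun i => n i))
      a ^+ (\sum_i size (primes (n i))))%:E)%E.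
Proof.
under eq_fun do rewrite sum_g.
pose B := #|{ffun V -> bool}|.
have B0 : (0 < B)%N by apply/card_gt0P; exists [ffun=> true].
have B0' : 0 < B%:R :> R by rewrite ltr0n.
rewrite -(@lee_pmul2l _ B%:R%:E)//.
have mS (s : {ffun V -> bool}) : measurable_fun setT (fun w =>
    hs_norm (\sum_(v : V) (-1) ^+ sign_parity s v *: g v w) ^+ (2 * k)).
  apply: measurable_hs_norm; apply: coord_measurable_sum => v.
  apply: coord_measurable_sign; rewrite /g; case sv: (squarefree_pred v).
    by apply: f_measurable; case/andP: sv => _ /asboolP.
  exact: coord_measurable_cst.
have mh (v : V) : measurable_fun setT (h v).
  rewrite /h; case sv: (squarefree_pred v); last exact: measurable_cst.
  case/andP: sv => _ /asboolP sv.
  apply: measurable_funM => //.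
  by apply: measurable_hs_norm; exact: f_measurable.
have Eh (v : V) : squarefree_pred v -> (\int[P]_w (h v w)%:E <= C%:E)%E.
  move=> sv; rewrite /h sv; case/andP: sv => _ /asboolP sv; have := f_moment sv.
  have a_gt0 : 0 < a ^+ (2 * k * size (primes v)) by exact: exprn_gt0.
  rewrite expectationE => Ef.
  rewrite (eq_integral (fun w => ((a ^+ (2 * k * size (primes v)))^-1%:E *
      (hs_norm (f v w) ^+ (2 * k))%:E)%E)); last first.
    by move=> w _; rewrite mulrC EFinM.
  rewrite ge0_integralZl//=.
  - by rewrite lee_pdivrMl// -EFinM mulrC.
  - apply/measurable_EFinP; apply: measurable_hs_norm; exact: f_measurable.
  - by move=> w _; rewrite lee_fin exprn_ge0 ?hs_norm_ge0.
  - by rewrite lee_fin invr_ge0 ltW.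
have -> : (B%:R%:E * 'E_P[fun w => (hs_norm (\sum_v g v w) ^+ (2 * k))%R] =
  \int[P]_w (\sum_(s : {ffun V -> bool})
    hs_norm (\sum_(v : V) (-1) ^+ sign_parity s v *: g v w) ^+ (2 * k))%:E)%E.
  under eq_integral do rewrite -sumEFin.
  rewrite ge0_integral_sum//; last 2 first.
  - by move=> s; apply/measurable_EFinP; exact: mS.
  - by move=> s w _; rewrite lee_fin exprn_ge0 ?hs_norm_ge0.
  rewrite (eq_bigr (fun=> 'E_P[fun w => (hs_norm (\sum_v g v w) ^+ (2 * k))%R])%E).
    by rewrite sumr_const mule_natl.
  by move=> s _; rewrite -(sign_invariant s) expectationE.
pose c (n : tuples) : R := B%:R * a ^+ (\sum_i size (primes (n i))).
have c0 n : 0 <= c n by rewrite mulr_ge0// exprn_ge0// ltW.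
pose sq := seq.filter (fun n : tuples => square_tuple X (fun i => n i)) (index_enum _).
apply: (@le_trans _ _ (\int[P]_w \sum_(n <- sq) \sum_i (c n * h (n i) w)%:E)%E).
  apply: ge0_le_integral => //.
  - by move=> w _; rewrite lee_fin sumr_ge0// => s _; rewrite exprn_ge0 ?hs_norm_ge0.
  - by apply/measurable_EFinP; apply: measurable_sum => s; exact: mS.
  - apply: emeasurable_sum => n; apply: emeasurable_sum => i.
    by apply/measurable_EFinP; apply: measurable_funM.
  - move=> w _.
    have -> : (\sum_(n <- sq) \sum_i (c n * h (n i) w)%:E =
        (\sum_(n <- sq) \sum_i c n * h (n i) w)%:E)%E.
      by rewrite -sumEFin; apply: eq_bigr => n _; rewrite sumEFin.
    rewrite lee_fin; apply: le_trans (pointwise_le w) _.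
    rewrite big_filter mulr_sumr; apply: ler_sum => n _.
    by rewrite -mulr_sumr mulrA.
rewrite ge0_integral_sum//; last 2 first.
- move=> n; apply: emeasurable_sum => i.
  by apply/measurable_EFinP; apply: measurable_funM.
- by move=> n w _; rewrite sume_ge0// => i _; rewrite lee_fin mulr_ge0.
rewrite -EFinM mulrCA mulr_sumr mulr_sumr -sumEFin big_filter; apply: lee_sum => n sqn.
rewrite ge0_integral_sum//; last 2 first.
- by move=> i; apply/measurable_EFinP; apply: measurable_funM.
- by move=> i w _; rewrite lee_fin mulr_ge0.
apply: (@le_trans _ _ (\sum_(i : 'I_k * bool) (c n * C)%:E)%E).
  apply: lee_sum => i _; under eq_integral do rewrite EFinM.
  rewrite ge0_integralZl//=.
  - rewrite [leRHS]EFinM; apply: lee_wpmul2l; first by rewrite lee_fin.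
    by apply: Eh; case/andP: sqn => /forallP.
  - exact/measurable_EFinP.
  - by move=> w _; rewrite lee_fin.
  - by rewrite lee_fin.
rewrite sumEFin lee_fin sumr_const card_prod card_ord card_bool /c mulnC.
by rewrite -[leLHS]mulr_natr le_eqVlt; apply/orP; left; apply/eqP; ring.
Qed.
End SquareTupleBound.

(** * Passage from dyadic scales to x and ln x *)

Lemma succ_trunc_log_le (R : realType) (x : R) (n : nat) : 2 <= x -> (0 < n)%N ->
  n%:R <= x -> (trunc_log 2 n).+1%:R <= 2 / ln 2 * ln x.
Proof.
move=> x2 n0 nx.
have ln2 : 0 < ln (2 : R) by rewrite ln_gt0// ltr1n.
have ln2x : ln 2 <= ln x by rewrite ler_ln ?posrE// (lt_le_trans _ x2).
(* The integral part of log_2 n is at most log_2 x, and so is the added 1 because x >= 2; this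
   explains the factor 2. *)
have : (trunc_log 2 n)%:R * ln 2 <= ln x.
  rewrite mulr_natl -lnXn// ler_ln ?posrE ?exprn_gt0// ?(lt_le_trans _ x2)//.
  apply: le_trans nx; rewrite -natrX ler_nat; exact: trunc_logP.
move=> H; rewrite -natr1 mulrAC ler_pdivlMr//; nra.
Qed.

Theorem theorem9 (R : realType) (d k : nat) (hd : (1 <= d)%N) (hk : (2 <= k)%N)
    (disp0 : measure_display) (T0 : measurableType disp0) (P0 : probability T0 R)
    (X : T0 -> 'M[R[i]]_d)
    (hX : random_mx X) (hsym : symmetric_mx P0 X) (hmean : centered_mx P0 X)
    (hmoment : 'E_P0[fun w => (hs_norm (X w) ^+ (2 * k)
                  * \1_[set w' | r < hs_norm (X w') ^+ (2 * k)] w)%R]%E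
                @[r --> +oo] --> 0%E)
    (disp1 : measure_display) (T1 : measurableType disp1) (P1 : probability T1 R)
    (Y : nat -> T1 -> 'M[R[i]]_d)
    (hY : iid_copies P0 X P1 [set: nat] Y) :
  let rho := spectral_radius P1 Y (2 * k)%:R in
  exists C : R,
    forall (disp : measure_display) (T : measurableType disp)
      (P : probability T R) (f : nat -> T -> 'M[R[i]]_d),
    random_mult_fun P0 X P f ->
    forall x : R, 2 <= x ->
    ('E_P[fun w => (hs_norm (\sum_(1 <= n < (Num.truncn x).+1) f n w) ^+ (2 * k))%R]
     <= (C * (x ^+ k * ln x ^ (Num.floor (rho ^+ 2 + 1) * ('C(2 * k, 2))%:Z
                               - (2 * k)%:Z)))%R%:E)%E.
Proof.
move=> rho.
have k0 : (0 < k)%N by exact: ltn_trans hk.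
have X_fin := expectation_lt_pinfty_of_truncation hX hmoment.
have [N [C0 [N0 floorE C0_ge0 growth]]] := product_moment_growth hX hY k0 X_fin.
pose m := (N * 'C(k.*2, 2) - k.*2)%N.
(* As k >= 2, binom(2k, 2) = k (2k - 1) is at least 2k. Hence the integer exponent is the natural
   number m, with no truncation in the subtraction. *)
have le_m : (k.*2 <= N * 'C(k.*2, 2))%N.
  apply: leq_trans (leq_pmull _ N0).
  by rewrite bin2 -doubleMl doubleK -muln2 leq_mul2l; lia.
have -> : Num.floor (rho ^+ 2 + 1) * ('C(2 * k, 2))%:Z - (2 * k)%:Z = m%:Z.
  by rewrite floorE -PoszM mul2n subzn.
set a : R := Num.sqrt N%:R in growth.
have a0 : 0 < a by rewrite sqrtr_gt0 ltr0n.
have aN : a ^+ 2 = N%:R by rewrite sqr_sqrtr.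
(* The factors come from [multiplicative_moment_le], from the 2k geometric series, and from
   [succ_trunc_log_le]; all are fixed before f and x. *)
exists (C0 * (2 * k)%:R * (4 ^+ k.*2 * (2 / ln 2) ^+ m)).
move=> disp T P f hf x x2.
have xn : (Num.truncn x)%:R <= x by rewrite truncn_le// (le_trans _ x2).
have n0 : (0 < Num.truncn x)%N by rewrite truncn_gt0 (le_trans _ x2)// ler1n.
have f_moment v : squarefree v ->
    ('E_P[fun w => (hs_norm (f v w) ^+ (2 * k))%R] <=
     (C0 * a ^+ (2 * k * size (primes v)))%:E)%E.
  case: hf => _ iid_f fprod sv; apply: le_trans (growth _).
  rewrite -(expectation_copy hY (2 * k) iid_f (primes_uniq v)) => [|p].
    by under eq_fun do rewrite fprod//.
  by rewrite mem_primes => /andP[].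
apply: le_trans (multiplicative_moment_le (Num.truncn x) hsym hf k0 a0 f_moment) _.
rewrite lee_fin -!mulrA !ler_wpM2l// !mulrA.
have card_tuple : #|{: 'I_k * bool}| = k.*2.
  by rewrite card_prod card_ord card_bool muln2.
apply: le_trans (weighted_square_tuples_le card_tuple hk N0 n0 aN _) _.
  by move=> n; apply: square_tupleP => i; rewrite -ltnS.
rewrite mulrC -!mulrA ler_wpM2l ?exprn_ge0// mulrCA.
have ln_x : 0 <= ln x by rewrite ln_ge0// (le_trans _ x2)// ler1n.
have l2x : 2 ^+ trunc_log 2 (Num.truncn x) <= x.
  by apply: le_trans xn; rewrite -natrX ler_nat trunc_logP.
have ln2 : 0 <= ln (2 : R) by rewrite ln_ge0// ler1n.
have x0 : 0 <= x by exact: le_trans x2.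
apply: ler_pM; rewrite ?exprn_ge0//.
  by rewrite lerXn2r ?nnegrE ?exprn_ge0.
rewrite -exprMn lerXn2r ?nnegrE ?mulr_ge0 ?invr_ge0//.
exact: succ_trunc_log_le.
Qed.
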